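(* Let $Q=(Q_0,Q_1,h,t)$ be a quiver without oriented cycles equipped with an involution $\tau$. Let $\alpha\in\mathbb N^{Q_0}$ and $\sigma\in\mathbb Z^{Q_0}$ be such that $\alpha=\tau\cdot\alpha$ and $\sigma=-\tau\cdot\sigma$. Then $\sigma\in\Sigma(Q,\alpha)$ if and only if $\sigma(\beta)\leqslant 0$ for all $\beta\in\mathbb N^{Q_0}$ such that (1) $\gamma:=\alpha-\beta-\tau\cdot\beta\in\mathbb N^{Q_0}$; (2) $\langle\beta,\cdot\rangle\in\Sigma(Q,\gamma)\cap\Sigma(Q,\tau\cdot\beta)$.
   Context: $\mathbb N$ denotes the non-negative integers. A quiver is a finite oriented graph with vertex set $Q_0$, arrow set $Q_1$, and maps $h,t:Q_1\to Q_0$; an arrow $a$ goes from its tail $ta$ to its head $ha$. A dimension is an element $\alpha\in\mathbb N^{Q_0}$. Representations of dimension $\alpha$ are the elements of $\mathrm{Rep}_\alpha(Q)=\bigoplus_{a\in Q_1}\mathrm{Mat}_{\alpha(ha),\alpha(ta)}(\mathbb C)$. The group $\mathrm{GL}_\alpha(Q)=\prod_{x\in Q_0}\mathrm{GL}_{\alpha(x)}(\mathbb C)$ acts by $g\cdot V=(g_{ha}V(a)g_{ta}^{-1})_a$, and on polynomial functions $f\in\mathbb C[\mathrm{Rep}_\alpha(Q)]$ by $(g\cdot f)(V)=f(g^{-1}\cdot V)$. A weight is an element $\sigma\in\mathbb Z^{Q_0}$; for $\beta\in\mathbb Z^{Q_0}$ put $\sigma(\beta)=\sum_{x\in Q_0}\sigma(x)\beta(x)$,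 and let $\chi_\sigma(g)=\prod_{x}\det(g_x)^{\sigma(x)}$. Let $\mathrm{SI}(Q,\alpha)_\sigma$ be the space of all $f\in\mathbb C[\mathrm{Rep}_\alpha(Q)]$ with $g\cdot f=\chi_\sigma(g)f$ for all $g\in\mathrm{GL}_\alpha(Q)$, and $\Sigma(Q,\alpha)=\{\sigma\in\mathbb Z^{Q_0}\mid \mathrm{SI}(Q,\alpha)_\sigma\neq\{0\}\}$. The Euler-Ringel form is $\langle\alpha,\beta\rangle=\sum_{x\in Q_0}\alpha(x)\beta(x)-\sum_{a\in Q_1}\alpha(ta)\beta(ha)$, and $\langle\alpha,\cdot\rangle$ denotes the weight $\sigma$ such that $\sigma(\beta)=\langle\alpha,\beta\rangle$ for all $\beta\in\mathbb Z^{Q_0}$. An involution $\tau$ of $Q$ is a pair $(\tau_0,\tau_1)$ of self-inverse maps $\tau_0:Q_0\to Q_0$, $\tau_1:Q_1\to Q_1$ with $h\circ\tau_1=\tau_0\circ t$ and $t\circ\tau_1=\tau_0\circ h$ (both are written $\tau$). It acts on $\mathbb Z^{Q_0}$ by $(\tau\cdot\alpha)(x)=\alpha(\tau x)$. *)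

(* Defs.v *)
From HB Require Import structures.
From mathcomp Require Import all_boot all_order all_algebra.
From mathcomp Require Import reals.
From mathcomp Require Import complex.
From mathcomp Require Import mpoly.

Set Implicit Arguments.
Unset Strict Implicit.
Unset Printing Implicit Defensive.

Import Order.TTheory GRing.Theory Num.Theory.
Local Open Scope ring_scope.

Record quiver := Quiver {
  vertex : finType;
  arrow : finType;
  qhead : arrow -> vertex;
  qtail : arrow -> vertex }.

(* The one-element cycles are the loops. *)
Definition acyclic (Q : quiver) : Prop :=
  forall s : seq (arrow Q),
    path.cycle [rel a b : arrow Q | qhead a == qtail b] s -> s = [::].

Record involution (Q : quiver) := Involution {
  inv0 : vertex Q -> vertex Q;
  inv1 : arrow Q -> arrow Q;
  inv0K : involutive inv0;
  inv1K : involutive inv1;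
  head_inv1 : forall a, qhead (inv1 a) = inv0 (qtail a);
  tail_inv1 : forall a, qtail (inv1 a) = inv0 (qhead a) }.

Notation dimvec Q := {ffun vertex Q -> nat}.
Notation weight Q := {ffun vertex Q -> int}.

Definition dimZ (Q : quiver) (alpha : dimvec Q) : weight Q :=
  [ffun x => (alpha x)%:Z].

Definition inv_act (Q : quiver) (tau : involution Q) (T : Type)
    (v : {ffun vertex Q -> T}) : {ffun vertex Q -> T} :=
  [ffun x => v (inv0 tau x)].

Definition pairing (Q : quiver) (sigma beta : weight Q) : int :=
  \sum_(x : vertex Q) sigma x * beta x.

Definition euler (Q : quiver) (alpha beta : weight Q) : int :=
  \sum_(x : vertex Q) alpha x * beta x
  - \sum_(a : arrow Q) alpha (qtail a) * beta (qhead a).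

(* The weight <alpha, .>, given by its values on the standard basis; see
   [euler_weightP]. *)
Definition euler_weight (Q : quiver) (alpha : weight Q) : weight Q :=
  [ffun y => euler alpha [ffun x => (x == y)%:Z]].

Lemma pairing_delta (Q : quiver) (sigma : weight Q) (y : vertex Q) :
  pairing sigma [ffun x => (x == y)%:Z] = sigma y.
Proof.
rewrite /pairing (bigD1 y) //= ffunE eqxx mulr1 big1 ?addr0 // => x /negPf nxy.
by rewrite ffunE nxy mulr0.
Qed.

Lemma euler_weightP (Q : quiver) (alpha sigma : weight Q) :
  (forall beta, pairing sigma beta = euler alpha beta)
  <-> sigma = euler_weight alpha.
Proof.
split=> [sE|-> beta]; first by apply/ffunP => y; rewrite ffunE -sE pairing_delta.
rewrite /pairing /euler.
under eq_bigr => y _ do rewrite ffunE /euler mulrBl.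
rewrite sumrB; congr (_ - _).
  apply: eq_bigr => y _; congr (_ * _).
  rewrite (bigD1 y) //= ffunE eqxx mulr1 big1 ?addr0 // => x /negPf nxy.
  by rewrite ffunE nxy mulr0.
under eq_bigr => y _ do rewrite mulr_suml.
rewrite exchange_big /=; apply: eq_bigr => a _.
rewrite (bigD1 (qhead a)) //= ffunE eqxx mulr1 big1 ?addr0 // => y nya.
by rewrite ffunE eq_sym (negPf nya) mulr0 mul0r.
Qed.

Section Representations.
Variables (R : realType) (Q : quiver) (alpha : dimvec Q).

Definition rep : Type :=
  forall a : arrow Q, 'M[R[i]]_(alpha (qhead a), alpha (qtail a)).

Definition GLfam : Type := forall x : vertex Q, 'M[R[i]]_(alpha x).

Definition in_GL (g : GLfam) : Prop := forall x, g x \in unitmx.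

Definition GL_inv (g : GLfam) : GLfam := fun x => invmx (g x).

Definition rep_act (g : GLfam) (V : rep) : rep :=
  fun a => g (qhead a) *m V a *m invmx (g (qtail a)).

(* The entries (a, (i, j)) of a representation, i.e. the coordinates on
   [rep]. *)
Definition rep_index : finType :=
  {a : arrow Q & ('I_(alpha (qhead a)) * 'I_(alpha (qtail a)))%type}.

Definition rep_coord (V : rep) (c : rep_index) : R[i] :=
  V (tag c) (tagged c).1 (tagged c).2.

Definition polynomial_fun (f : rep -> R[i]) : Prop :=
  exists p : {mpoly R[i][#|rep_index|]},
    forall V, f V = p.@[fun i => rep_coord V (enum_val i)].

Definition chi (sigma : weight Q) (g : GLfam) : R[i] :=
  \prod_(x : vertex Q) (\det (g x)) ^ (sigma x).

Definition fun_act (g : GLfam) (f : rep -> R[i]) : rep -> R[i] :=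
  fun V => f (rep_act (GL_inv g) V).

Definition SI (sigma : weight Q) (f : rep -> R[i]) : Prop :=
  polynomial_fun f /\
  forall g, in_GL g -> forall V, fun_act g f V = chi sigma g * f V.

Definition Sigma (sigma : weight Q) : Prop :=
  exists f, SI sigma f /\ exists V, f V != 0.

End Representations.

Arguments Sigma R [Q] alpha sigma.

(* Main.v *)
(* For a representation B of dimension beta with framings M_x : C^{mu x} -> B_x,
   the complex
     d : (+)_x Hom(B_x, V_x) -> (+)_a Hom(B_ta, V_ha) (+) (+)_x Hom(C^{mu x}, V_x)
   has Euler characteristic sigma(dim V) for sigma = <beta, .> - mu, and since Q
   is acyclic every weight has this form.  If d is invertible, its determinant
   is a semi-invariant of weight sigma.  If (B, M, V) has minimal coker d, every
   morphism phi : B -> V extends to first order along every deformation of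
   (B, M), which forces coker d to stay the same when V is replaced by
   coker phi.  Iterating, a generic V has a quotient C with - sigma(C) equal to
   the generic dimension of coker d, and this quotient extends along all
   rational curves through V.

   If sigma is not in Sigma(Q, alpha), apply this to N sigma - w, where w > 0
   separates the dimension vectors below alpha and N is large: a generic V has
   a unique subrepresentation B maximizing N sigma - w, and sigma(B) > 0.
   Maximality gives Hom(B, V/B) = 0, and the liftability of the quotient V/B
   gives Ext(B, V/B) = 0.  The dual of V is generic as well, so V has a quotient
   D of dimension tau beta; Hom(B, D) = 0, hence D is a quotient of V/B, and B
   is orthogonal to D and to the kernel of V/B -> D.

   Conversely, condition (2) gives B, W1, W2 of dimensions beta, gamma, tau beta
   with Ext(B, W1) = Ext(B, W2) = 0.  Along any line through B + W1 + W2 the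
   equation for a subrepresentation of dimension beta close to B is solvable
   modulo t^n for all n, so a nonzero polynomial cannot vanish at all
   representations having such a subrepresentation; where a semi-invariant of
   weight sigma does not vanish, a one-parameter subgroup gives
   sigma(beta) <= 0. *)

From HB Require Import structures.
From mathcomp Require Import all_boot all_order all_algebra.
From mathcomp Require Import reals complex mpoly.
From mathcomp Require Import ring lra zify.
From Stdlib Require Import Classical FunctionalExtensionality.
Require Import Defs.

Set Implicit Arguments.
Unset Strict Implicit.
Unset Printing Implicit Defensive.

Import Order.TTheory GRing.Theory Num.Theory.
Local Open Scope ring_scope.

(** * Rational functions and matrices of one variable near 0 *)

Section RationalGerms.
Variable K : numFieldType.

Lemma poly_nonroot (p : {poly K}) : p != 0 -> exists t, p.[t] != 0.
Proof.
move=> p0; apply: NNPP => H.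
have /(max_poly_roots p0) : all (root p) [seq i%:R | i <- iota 0 (size p)].
  by apply/allP => x _; rewrite rootE; case: eqP => // /eqP px; case: H; exists x.
rewrite map_inj_uniq ?iota_uniq => [/(_ isT)|i j /eqP]; last by rewrite eqr_nat => /eqP.
by rewrite size_map size_iota ltnn.
Qed.

Lemma poly_eq0_of_nonzero (p : {poly K}) : (forall t, t != 0 -> p.[t] = 0) -> p = 0.
Proof.
move=> H; apply/eqP/negPn/negP => p0.
have /poly_nonroot[t] : p * 'X != 0 by rewrite mulf_neq0 // polyX_eq0.
rewrite hornerM hornerX; have [->|t0] := eqVneq t 0; first by rewrite mulr0 eqxx.
by rewrite H // mul0r eqxx.
Qed.

(* "For t in a Zariski neighbourhood of 0" and "rational and regular at 0". *)
Definition ev (P : K -> Prop) : Prop :=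
  exists2 D : {poly K}, D.[0] != 0 & forall t, D.[t] != 0 -> P t.

Definition reg (u : K -> K) : Prop :=
  exists P D : {poly K}, D.[0] != 0 /\ forall t, D.[t] != 0 -> u t = P.[t] / D.[t].

Lemma evT (P : K -> Prop) : (forall t, P t) -> ev P.
Proof. by move=> H; exists 1; rewrite ?hornerC ?oner_neq0. Qed.

Lemma ev_and (P1 P2 : K -> Prop) : ev P1 -> ev P2 -> ev (fun t => P1 t /\ P2 t).
Proof.
move=> [D1 n1 H1] [D2 n2 H2]; exists (D1 * D2); first by rewrite hornerM mulf_neq0.
by move=> t; rewrite hornerM mulf_eq0 negb_or => /andP[/H1 ? /H2].
Qed.

Lemma ev_imp (P1 P2 : K -> Prop) : (forall t, P1 t -> P2 t) -> ev P1 -> ev P2.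
Proof. by move=> H [D n1 H1]; exists D => // t /H1/H. Qed.

Lemma ev_all (I : finType) (P : I -> K -> Prop) :
  (forall i, ev (P i)) -> ev (fun t => forall i, P i t).
Proof.
move=> H; suff: forall s : seq I, ev (fun t => forall i, i \in s -> P i t).
  by move/(_ (enum I)); apply: ev_imp => t Ht i; apply: Ht; rewrite mem_enum.
elim=> [|i s IH]; first exact: evT.
apply: ev_imp (ev_and (H i) IH) => t [Hi Hs] j.
by rewrite inE => /orP[/eqP->//|/Hs].
Qed.

(** Joins a condition valid near one end of a segment to one valid near the other end: a product of
    nonzero polynomials has a non-root. *)
Lemma ev_pick (P1 P2 : K -> Prop) :
  ev P1 -> ev P2 -> exists t, P1 t /\ P2 (1 - t).
Proof.
move=> [D1 n1 H1] [D2 n2 H2].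
have nz (D : {poly K}) a : D.[a] != 0 -> D != 0.
  by apply: contraNneq => ->; rewrite horner0.
have [|t] := @poly_nonroot (D1 * (D2 \Po (1 - 'X))).
  by rewrite mulf_neq0 ?(nz _ _ n1) // (nz _ 1) // horner_comp !hornerE subrr.
rewrite hornerM mulf_eq0 negb_or horner_comp !hornerE => /andP[/H1 ? /H2 ?].
by exists t.
Qed.

Lemma reg_const c : reg (fun=> c).
Proof. by exists c%:P, 1; split=> [|t _]; rewrite !hornerC ?oner_neq0 ?divr1. Qed.

Lemma reg_poly (p : {poly K}) : reg (fun t => p.[t]).
Proof. by exists p, 1; split=> [|t _]; rewrite !hornerC ?oner_neq0 ?divr1. Qed.

Lemma reg_id : reg (fun t => t).
Proof. by exists 'X, 1; split=> [|t _]; rewrite ?hornerX !hornerC ?oner_neq0 ?divr1. Qed.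

Lemma reg_add u v : reg u -> reg v -> reg (fun t => u t + v t).
Proof.
move=> [P1 [D1 [n1 H1]]] [P2 [D2 [n2 H2]]].
exists (P1 * D2 + P2 * D1), (D1 * D2); split; first by rewrite hornerM mulf_neq0.
move=> t; rewrite hornerM mulf_eq0 negb_or => /andP[d1 d2].
by rewrite H1 // H2 // !hornerE addf_div.
Qed.

Lemma reg_mul u v : reg u -> reg v -> reg (fun t => u t * v t).
Proof.
move=> [P1 [D1 [n1 H1]]] [P2 [D2 [n2 H2]]].
exists (P1 * P2), (D1 * D2); split; first by rewrite hornerM mulf_neq0.
move=> t; rewrite hornerM mulf_eq0 negb_or => /andP[d1 d2].
by rewrite H1 // H2 // !hornerM mulf_div.
Qed.

Lemma reg_opp u : reg u -> reg (fun t => - u t).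
Proof.
move=> /(reg_mul (reg_const (-1)))[P [D [n H]]]; exists P, D; split=> // t /H <-.
by rewrite mulN1r.
Qed.

Lemma reg_ext u v : (forall t, u t = v t) -> reg u -> reg v.
Proof. by move=> H [P [D [n E]]]; exists P, D; split=> // t /E <-. Qed.

Lemma reg_ev u v : ev (fun t => u t = v t) -> reg u -> reg v.
Proof.
move=> [D1 n1 H1] [P [D [n H]]]; exists (P * D1), (D * D1).
split; first by rewrite hornerM mulf_neq0.
move=> t; rewrite hornerM mulf_eq0 negb_or => /andP[d d1].
by rewrite -H1 // H // !hornerE -mulf_div divff ?mulr1.
Qed.

Lemma reg_sum (I : Type) (r : seq I) (P : pred I) (F : I -> K -> K) :
  (forall i, reg (F i)) -> reg (fun t => \sum_(i <- r | P i) F i t).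
Proof.
move=> H; elim: r => [|i r IH].
  by apply: reg_ext (reg_const 0) => t; rewrite big_nil.
case Pi: (P i); last by apply: reg_ext IH => t; rewrite big_cons Pi.
by apply: reg_ext (reg_add (H i) IH) => t; rewrite big_cons Pi.
Qed.

Lemma reg_prod (I : Type) (r : seq I) (P : pred I) (F : I -> K -> K) :
  (forall i, reg (F i)) -> reg (fun t => \prod_(i <- r | P i) F i t).
Proof.
move=> H; elim: r => [|i r IH].
  by apply: reg_ext (reg_const 1) => t; rewrite big_nil.
case Pi: (P i); last by apply: reg_ext IH => t; rewrite big_cons Pi.
by apply: reg_ext (reg_mul (H i) IH) => t; rewrite big_cons Pi.
Qed.

Lemma reg_neq0 u : reg u -> u 0 != 0 -> ev (fun t => u t != 0).
Proof.
move=> [P [D [n H]]]; rewrite H // mulf_eq0 negb_or => /andP[p0 _].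
exists (P * D); first by rewrite hornerM mulf_neq0.
move=> t; rewrite hornerM mulf_eq0 negb_or => /andP[d1 d2].
by rewrite H // mulf_neq0 ?invr_eq0.
Qed.

Lemma reg_inv u : reg u -> u 0 != 0 -> reg (fun t => (u t)^-1).
Proof.
move=> [P [D [n H]]]; rewrite H // mulf_eq0 negb_or => /andP[p0 _].
exists (D * D), (P * D); split; first by rewrite hornerM mulf_neq0.
move=> t; rewrite hornerM mulf_eq0 negb_or => /andP[d d1].
by rewrite H // !hornerE -mulf_div divff ?mulr1 // invf_div.
Qed.

(** Replaces continuity at 0: the numerator vanishes off finitely many points, hence identically. *)
Lemma reg_eq0 u : reg u -> ev (fun t => t != 0 -> u t = 0) -> u 0 = 0.
Proof.
move=> [P [D [n H]]] [D1 n1 H1].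
suff P0 : P = 0 by rewrite H // P0 horner0 mul0r.
have /eqP : P * (D * D1) = 0.
  apply: poly_eq0_of_nonzero => t t0; rewrite !hornerM; apply/eqP.
  have [->|d1] := eqVneq D1.[t] 0; first by rewrite !mulr0.
  have [->|d] := eqVneq D.[t] 0; first by rewrite mul0r mulr0.
  have /eqP := H1 _ d1 t0; rewrite H // mulf_eq0 invr_eq0 (negPf d) orbF => /eqP->.
  by rewrite mul0r.
rewrite mulf_eq0 => /orP[/eqP//|]; rewrite mulf_eq0 => /orP[]/eqP E.
  by case/negP: n; rewrite E horner0.
by case/negP: n1; rewrite E horner0.
Qed.

(** The numerator of [u - u 0] has the root 0, so the difference quotient is again regular; [v 0]
    serves as the derivative. *)
Lemma reg_quot u : reg u -> exists2 v, reg v & ev (fun t => u t = u 0 + t * v t).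
Proof.
move=> [P [D [n H]]].
have /factor_theorem[q Eq] : root (D.[0] *: P - P.[0] *: D) 0.
  by rewrite rootE !hornerE mulrC subrr.
exists (fun t => q.[t] / (D.[0] * D.[t])).
  exists q, (D.[0] *: D); split=> [|t _]; first by rewrite hornerZ mulf_neq0.
  by rewrite hornerZ.
exists D => // t d; rewrite !H //; 
have E : D.[0] * P.[t] - P.[0] * D.[t] = q.[t] * t.
  by have := congr1 (horner^~ t) Eq; rewrite !hornerE subr0.
have -> : P.[t] = (q.[t] * t + P.[0] * D.[t]) / D.[0].
  by rewrite -E subrK mulrC mulKf.
by field; rewrite n d.
Qed.

Definition regM m n (A : K -> 'M[K]_(m, n)) := forall i j, reg (fun t => A t i j).

Lemma regM_const m n (A : 'M[K]_(m, n)) : regM (fun=> A).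
Proof. by move=> i j; exact: reg_const. Qed.

Lemma regM_ev m n (A B : K -> 'M[K]_(m, n)) :
  ev (fun t => A t = B t) -> regM A -> regM B.
Proof. by move=> E H i j; apply: reg_ev (H i j); apply: ev_imp E => t ->. Qed.

Lemma regM_add m n (A B : K -> 'M[K]_(m, n)) :
  regM A -> regM B -> regM (fun t => A t + B t).
Proof.
by move=> HA HB i j; apply: reg_ext (reg_add (HA i j) (HB i j)) => t; rewrite mxE.
Qed.

Lemma regM_opp m n (A : K -> 'M[K]_(m, n)) : regM A -> regM (fun t => - A t).
Proof. by move=> HA i j; apply: reg_ext (reg_opp (HA i j)) => t; rewrite mxE. Qed.

Lemma regM_sub m n (A B : K -> 'M[K]_(m, n)) :
  regM A -> regM B -> regM (fun t => A t - B t).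
Proof. by move=> HA HB; apply/regM_add/regM_opp. Qed.

Lemma regM_scale m n u (A : K -> 'M[K]_(m, n)) :
  reg u -> regM A -> regM (fun t => u t *: A t).
Proof.
by move=> Hu HA i j; apply: reg_ext (reg_mul Hu (HA i j)) => t; rewrite mxE.
Qed.

Lemma regM_mul m n p (A : K -> 'M[K]_(m, n)) (B : K -> 'M[K]_(n, p)) :
  regM A -> regM B -> regM (fun t => A t *m B t).
Proof.
move=> HA HB i j.
have H k : reg (fun t => A t i k * B t k j) by apply: reg_mul.
by apply: reg_ext (reg_sum (index_enum _) xpredT H) => t; rewrite mxE.
Qed.

Lemma regM_line m n (A B : 'M[K]_(m, n)) : regM (fun t => A + t *: B).
Proof.
by apply: regM_add; [exact: regM_const|apply: regM_scale; [exact: reg_id|exact: regM_const]].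
Qed.

Lemma reg_det n (A : K -> 'M[K]_n) : regM A -> reg (fun t => \det (A t)).
Proof.
move=> HA; apply: reg_sum => s; apply: reg_mul; first exact: reg_const.
by apply: reg_prod => i; apply: HA.
Qed.

Lemma unitmx_ev n (A : K -> 'M[K]_n) :
  regM A -> A 0 \in unitmx -> ev (fun t => A t \in unitmx).
Proof.
move=> HA; rewrite unitmxE unitfE => /(reg_neq0 (reg_det HA)).
by apply: ev_imp => t; rewrite unitmxE unitfE.
Qed.

Lemma regM_inv n (A : K -> 'M[K]_n) :
  regM A -> A 0 \in unitmx -> regM (fun t => invmx (A t)).
Proof.
move=> HA A0; apply: (@regM_ev _ _ (fun t => (\det (A t))^-1 *: \adj (A t))).
  by apply: ev_imp (unitmx_ev HA A0) => t At; rewrite /invmx At.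
apply: regM_scale; first by apply/reg_inv; [exact: reg_det|rewrite -unitfE -unitmxE].
move=> i j; have H : regM (fun t => row' j (col' i (A t))).
  by move=> k l; apply: reg_ext (HA (lift j k) (lift i l)) => t; rewrite !mxE.
apply: reg_ext (reg_mul (reg_const ((-1) ^+ (j + i))) (reg_det H)) => t.
by rewrite mxE.
Qed.

Lemma regM_eq0 m n (A : K -> 'M[K]_(m, n)) :
  regM A -> ev (fun t => t != 0 -> A t = 0) -> A 0 = 0.
Proof.
move=> HA H; apply/matrixP => i j; rewrite mxE; apply: (reg_eq0 (HA i j)).
by apply: ev_imp H => t E /E ->; rewrite mxE.
Qed.

Lemma regM_quot m n (A : K -> 'M[K]_(m, n)) :
  regM A -> exists2 B, regM B & ev (fun t => A t = A 0 + t *: B t).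
Proof.
move=> HA.
have [|f Hf] := @fin_all_exists _ _ (fun ij v => reg v /\
  ev (fun t => A t ij.1 ij.2 = A 0 ij.1 ij.2 + t * v t)) (_ : forall ij : 'I_m * 'I_n, _).
  by move=> ij; have [v] := reg_quot (HA ij.1 ij.2); exists v.
exists (fun t => \matrix_(i, j) f (i, j) t).
  by move=> i j; apply: reg_ext (Hf (i, j)).1 => t; rewrite mxE.
have := ev_all (fun ij => (Hf ij).2); apply: ev_imp => t E.
by apply/matrixP => i j; rewrite !mxE (E (i, j)).
Qed.

(** For a generalized inverse [G] of [A 0], the matrix [T t = 1 - A 0 G + A t G] is the identity at
    0 and satisfies [T t A 0 = A t G A 0]. Hence the rank of [A t] cannot drop near 0. If it does
    not rise either, [A t] and [T t A 0] have the same left kernel, which contains [v] times the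
    inverse of [T t]. *)
Lemma rank_kernel_curve m n (A : K -> 'M[K]_(m, n)) : regM A ->
  ev (fun t => (\rank (A 0%R) <= \rank (A t))%N)
  /\ (ev (fun t => (\rank (A t) <= \rank (A 0%R))%N) ->
     forall k (v : 'M_(k, m)), v *m A 0 = 0 ->
     exists w, [/\ regM w, w 0 = v & ev (fun t => w t *m A t = 0)]).
Proof.
move=> HA; have [G AGA] : exists G, A 0 *m G *m A 0 = A 0.
  by exists (pinvmx (A 0)); rewrite mulmxKpV.
pose T t := 1%:M - A 0 *m G + A t *m G.
have HT : regM T.
  exact: regM_add (regM_const _) (regM_mul HA (regM_const G)).
have T0 : T 0 = 1%:M by rewrite /T subrK.
have UT0 : T 0 \in unitmx by rewrite T0 unitmx1.
have TA t : T t *m A 0 = A t *m (G *m A 0).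
  by rewrite mulmxDl mulmxBl mul1mx AGA subrr add0r mulmxA.
have rT t : T t \in unitmx -> \rank (A t *m (G *m A 0)) = \rank (A 0%R).
  by move=> Ut; rewrite -TA eqmxMfull // row_full_unit.
have HU := unitmx_ev HT UT0; split.
  by apply: ev_imp HU => t /rT <-; exact: mxrankM_maxl.
move=> Hr k v vA; exists (fun t => v *m invmx (T t)); split.
- by apply: regM_mul; [exact: regM_const|exact: regM_inv].
- by rewrite T0 invmx1 mulmx1.
apply: ev_imp (ev_and HU Hr) => t [Ut rt]; apply/eqP; rewrite -sub_kermx.
have kk : (kermx (A t) <= kermx (A t *m (G *m A 0)))%MS.
  by rewrite sub_kermx (mulmxA (kermx _)) mulmx_ker mul0mx.
have : (kermx (A t *m (G *m A 0)) <= kermx (A t))%MS.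
  rewrite -(geq_leqif (mxrank_leqif_sup kk)) !mxrank_ker rT //.
  by rewrite leq_sub2l.
apply: submx_trans; rewrite sub_kermx -TA mulmxA -(mulmxA v) mulVmx // mulmx1.
by rewrite vA.
Qed.

(* If the rank does not increase along the pencil [A0 + t A1], a kernel vector
   [v] of [A0] extends to a curve of kernel vectors; its first-order term
   witnesses [v A1 \in im A0]. *)
Lemma first_order_kernel m n (A0 A1 : 'M[K]_(m, n)) k (v : 'M_(k, m)) :
  (forall t, (\rank (A0 + t *: A1)%R <= \rank A0)%N) -> v *m A0 = 0 ->
  (v *m A1 <= A0)%MS.
Proof.
move=> Hr vA; have E0 : A0 + 0 *: A1 = A0 by rewrite scale0r addr0.
have [_] := rank_kernel_curve (regM_line A0 A1); rewrite E0.
case/(_ (evT Hr) k v vA) => w [Hw w0 Ew].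
have [w1 Hw1 Ew1] := regM_quot Hw.
have /eqP : v *m A1 + w1 0 *m A0 = 0.
  have -> : v *m A1 + w1 0 *m A0 = v *m A1 + w1 0 *m A0 + 0 *: (w1 0 *m A1).
    by rewrite scale0r addr0.
  (* [F t] is [w t (A0 + t A1)] divided by [t]. *)
  pose F t := v *m A1 + w1 t *m A0 + t *: (w1 t *m A1).
  apply: (@regM_eq0 _ _ F).
    apply: (regM_add _ (regM_scale reg_id (regM_mul Hw1 (regM_const A1)))).
    exact: (regM_add (regM_const _) (regM_mul Hw1 (regM_const A0))).
  apply: ev_imp (ev_and Ew Ew1) => t [+ E] t0; rewrite E w0 mulmxDl !mulmxDr vA add0r.
  rewrite -!scalemxAr -!scalemxAl -scalerDr -scalerDr => /eqP.
  by rewrite scaler_eq0 (negPf t0) /= addrA => /eqP.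
rewrite addr_eq0 => /eqP ->; rewrite -mulNmx; exact: submxMl.
Qed.

(** The rank condition makes the sequence given by [f] and [g] exact in the middle. *)
Lemma exact_lift m n p k (g : 'M[K]_(m, n)) (f : 'M_(n, p)) (x : 'M_(n, k)) :
  g *m f = 0 -> (n <= \rank g + \rank f)%N -> g *m x = 0 -> exists z, x = f *m z.
Proof.
move=> gf rgf gx.
have fk : (f^T <= kermx g^T)%MS by rewrite sub_kermx -trmx_mul gf trmx0.
have : (kermx g^T <= f^T)%MS.
  by rewrite -(geq_leqif (mxrank_leqif_sup fk)) mxrank_ker !mxrank_tr leq_subLR.
have : (x^T <= kermx g^T)%MS by rewrite sub_kermx -trmx_mul gx trmx0.
move=> /submx_trans H /H /submxP[z zE]; exists z^T.
by rewrite -[x]trmxK zE trmx_mul trmxK.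
Qed.

(** A cokernel [p] of [f] with a section [s]. The identity [1 = s p + f y] is the form in which the
    inclusion of the kernel of [p] in the image of [f] is used later. *)
Lemma coker_data d b (f : 'M[K]_(d, b)) :
  exists (p : 'M_(d - \rank f, d)) s y,
    [/\ p *m s = 1%:M, p *m f = 0 & 1%:M = s *m p + f *m y].
Proof.
rewrite -mxrank_ker; set p := row_base (kermx f).
have fp : row_free p by exact: row_base_free.
have pf : p *m f = 0.
  by apply/eqP; rewrite -sub_kermx eq_row_base submx_refl.
have ps := mulmxVp fp.
have [|||y yE] := @exact_lift _ _ _ _ p f (1%:M - pinvmx p *m p).
- exact: pf.
- by rewrite (eqP fp) mxrank_ker subnK // rank_leq_row.
- by rewrite mulmxBr mulmx1 mulmxA ps mul1mx subrr.
by exists p, (pinvmx p), y; rewrite -yE addrC subrK.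
Qed.

Lemma ker_data d b (f : 'M[K]_(d, b)) :
  exists (q : 'M_(b, b - \rank f)) r y,
    [/\ r *m q = 1%:M, f *m q = 0 & 1%:M = q *m r + y *m f].
Proof.
have := coker_data f^T; rewrite mxrank_tr => -[p [s [y [ps pf E]]]].
exists p^T, s^T, y^T; rewrite -!trmx_mul ps trmx1; split=> //.
  by apply: trmx_inj; rewrite trmx_mul trmxK pf trmx0.
by rewrite -trmx1 E linearD /= !trmx_mul trmxK.
Qed.

Lemma rank_right_inv m n (p : 'M[K]_(m, n)) : (exists s, p *m s = 1%:M) <-> \rank p = m.
Proof.
split=> [/row_freeP/eqP//|/eqP/row_freeP[s ps]]; by exists s.
Qed.

Lemma rank_left_inv m n (f : 'M[K]_(m, n)) : (exists r, r *m f = 1%:M) <-> \rank f = n.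
Proof.
split=> [/row_fullP/eqP//|/eqP/row_fullP[s ps]]; by exists s.
Qed.
End RationalGerms.

(** * Families of matrices as vectors, and linear maps between them *)

Section Families.
Variable K : numFieldType.

Definition fam (I : finType) (m n : I -> nat) : Type := forall i, 'M[K]_(m i, n i).

Section Vec.
Variables (I : finType) (m n : I -> nat).
Implicit Types f g : fam m n.

Definition fidx : finType := {i : I & ('I_(m i) * 'I_(n i))%type}.

Definition vec f : 'rV[K]_#|fidx| :=
  \row_k f (tag (enum_val k)) (tagged (enum_val k)).1 (tagged (enum_val k)).2.

Definition unvec (v : 'rV[K]_#|fidx|) : fam m n := fun i =>
  \matrix_(p, q) v 0 (enum_rank (Tagged (fun i => ('I_(m i) * 'I_(n i))%type) (p, q))).

Definition flin c f g : fam m n := fun i => c *: f i + g i.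

Definition regF (f : K -> fam m n) := forall i, regM (fun t => f t i).

(* Openness tested on rational curves, which is all that the proof needs. *)
Definition openF (O : fam m n -> Prop) :=
  forall w : K -> fam m n, regF w -> O (w 0) -> ev (fun t => O (w t)).

Lemma fam_ext f g : (forall i, f i = g i) -> f = g.
Proof. by move=> E; apply: functional_extensionality_dep. Qed.

Lemma vecK : cancel vec unvec.
Proof.
move=> f; apply: fam_ext => i; apply/matrixP => p q.
by rewrite !mxE enum_rankK.
Qed.

Lemma unvecK : cancel unvec vec.
Proof.
move=> v; apply/rowP => k; rewrite !mxE; congr (v 0 _).
rewrite -[RHS]enum_valK; congr enum_rank.
by case: (enum_val k) => i [p q].
Qed.

Lemma vec_lin c f g : vec (flin c f g) = c *: vec f + vec g.
Proof. by apply/rowP => k; rewrite !mxE. Qed.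

Lemma unvec_lin c u v : unvec (c *: u + v) = flin c (unvec u) (unvec v).
Proof. by apply: fam_ext => i; apply/matrixP => p q; rewrite !mxE. Qed.

Lemma vec_eq0 f : vec f = 0 <-> forall i, f i = 0.
Proof.
split=> [E i|E]; last by apply/rowP => k; rewrite !mxE E mxE.
by rewrite -[f]vecK E; apply/matrixP => p q; rewrite !mxE.
Qed.

Lemma regF_line f g : regF (fun t => flin t g f).
Proof.
move=> i; apply: regM_add; last exact: regM_const.
by apply: regM_scale; [exact: reg_id|exact: regM_const].
Qed.

Lemma flin0 f g : flin 0 g f = f.
Proof. by apply: fam_ext => i; rewrite /flin scale0r add0r. Qed.

Lemma openF_and O1 O2 : openF O1 -> openF O2 -> openF (fun f => O1 f /\ O2 f).
Proof. by move=> H1 H2 f rf [/(H1 _ rf) E1 /(H2 _ rf) E2]; exact: ev_and. Qed.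

Definition fseg f g t : fam m n := flin t (flin (-1) f g) f.

Lemma fseg0 f g : fseg f g 0 = f.
Proof. exact: flin0. Qed.

Lemma fseg_rev f g t : fseg f g (1 - t) = fseg g f t.
Proof.
apply: fam_ext => i; rewrite /fseg /flin !scaleN1r.
by apply/matrixP => p q; rewrite !mxE; ring.
Qed.

(** Irreducibility of affine space: the line joining a point of each set meets both sets outside
    finitely many parameters. *)
Lemma openF_meet O1 O2 : openF O1 -> openF O2 ->
  (exists f, O1 f) -> (exists g, O2 g) -> exists h, O1 h /\ O2 h.
Proof.
move=> H1 H2 [f Of] [g Og].
have [||t [t1 t2]] := @ev_pick _ (fun t => O1 (fseg f g t)) (fun t => O2 (fseg g f t)).
- by apply: H1; [exact: regF_line|rewrite fseg0].
- by apply: H2; [exact: regF_line|rewrite fseg0].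
by exists (fseg f g t); split=> //; rewrite -fseg_rev.
Qed.

End Vec.

Section LinMx.
Variables (I J : finType) (m n : I -> nat) (p q : J -> nat).
Implicit Types F : fam m n -> fam p q.

(** Acts on row vectors from the right, so that kernels are left kernels and composites multiply
    from left to right. *)
Definition lmx F : 'M[K]_(#|fidx m n|, #|fidx p q|) :=
  \matrix_k vec (F (unvec (delta_mx 0 k))).

Definition linF F := forall c f g, F (flin c f g) = flin c (F f) (F g).

Lemma mul_lmx F v : linF F -> v *m lmx F = vec (F (unvec v)).
Proof.
move=> HF; pose f v := vec (F (unvec v)).
have lf c u w : f (c *: u + w) = c *: f u + f w.
  by rewrite /f unvec_lin HF vec_lin.
have f0 : f 0 = 0 by have := lf (-1) 0 0; rewrite scaler0 addr0 scaleN1r addNr.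
rewrite -/(f v) mulmx_sum_row [in RHS](row_sum_delta v).
elim: (index_enum _) => [|k r IH]; first by rewrite !big_nil f0.
by rewrite !big_cons lf -IH rowK.
Qed.

Lemma vec_lmx F f : linF F -> vec f *m lmx F = vec (F f).
Proof. by move=> /mul_lmx ->; rewrite vecK. Qed.

Lemma lmx_reg (F : K -> fam m n -> fam p q) :
  (forall f, regF (fun t => F t f)) -> regM (fun t => lmx (F t)).
Proof.
move=> H k l.
have := H (unvec (delta_mx 0 k)) (tag (enum_val l)) (tagged (enum_val l)).1 (tagged (enum_val l)).2.
by apply: reg_ext => t; rewrite !mxE.
Qed.

Lemma lmx_lin F G c : lmx (fun f => flin c (G f) (F f)) = lmx F + c *: lmx G.
Proof. by apply/matrixP => k l; rewrite !mxE addrC. Qed.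

Lemma lmx_eq F G : (forall f, F f = G f) -> lmx F = lmx G.
Proof. by move=> E; apply/matrixP => k l; rewrite !mxE E. Qed.

End LinMx.

Lemma lmx_comp (I J L : finType) (m n : I -> nat) (p q : J -> nat) (r s : L -> nat)
  (F : fam m n -> fam p q) (G : fam p q -> fam r s) :
  linF F -> linF G -> lmx F *m lmx G = lmx (fun f => G (F f)).
Proof.
move=> HF HG; apply/row_matrixP => k; rewrite row_mul [row k (lmx F)]rowK rowK.
by rewrite vec_lmx.
Qed.

Lemma lmx_id (I : finType) (m n : I -> nat) : lmx (fun f : fam m n => f) = 1%:M.
Proof. by apply/row_matrixP => k; rewrite rowK unvecK row1. Qed.

End Families.
Arguments lmx_reg {K I J m n p q} F.

Lemma ex_maximum (T : Type) (P : T -> Prop) (f : T -> nat) (N : nat) :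
  (exists x, P x) -> (forall x, P x -> (f x <= N)%N) ->
  exists x, P x /\ forall y, P y -> (f y <= f x)%N.
Proof.
move=> [x0 Px0] bd; apply: NNPP => H.
have step k : exists x, P x /\ (k <= f x)%N.
  elim: k => [|k [x [Px le]]]; first by exists x0.
  apply: NNPP => H'; apply: H; exists x; split=> // y Py; rewrite leqNgt.
  by apply/negP => lt; apply: H'; exists y; split=> //; exact: leq_ltn_trans le lt.
by have [x [Px]] := step N.+1; rewrite ltnNge bd.
Qed.

Lemma leq_add_subn (a b r x y : nat) :
  (a <= b)%N -> (y <= b - a)%N -> (x <= r)%N -> (a + (x + y) <= b + r)%N.
Proof. lia. Qed.

(** * The two-term complex of a framed representation *)

Section Core.
Variables (K : numFieldType) (Q : quiver).

Notation rp d := (fam K (fun a : arrow Q => d (qhead a)) (fun a : arrow Q => d (qtail a))).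

Section Fixed.
Variables (beta mu : vertex Q -> nat).

(* The target of the complex [d] of the header: an arrow [a] indexes
   [Hom(B_ta, V_ha)] and a vertex [x] indexes [Hom(M_x, V_x)]. *)
Definition tgt_row (d : vertex Q -> nat) (i : arrow Q + vertex Q) :=
  match i with inl a => d (qhead a) | inr x => d x end.
Definition tgt_col (i : arrow Q + vertex Q) :=
  match i with inl a => beta (qtail a) | inr x => mu x end.

Notation frm := (fam K beta mu).
Notation hom0 d := (fam K (d : vertex Q -> nat) beta).
Notation hom1 d := (fam K (tgt_row d) tgt_col).

Definition dmap d (B : rp beta) (M : frm) (V : rp d) (f : hom0 d) : hom1 d :=
  fun i => match i return 'M[K]_(tgt_row d i, tgt_col i) with
           | inl a => f (qhead a) *m B a - V a *m f (qtail a)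
           | inr x => f x *m M x
           end.

Definition Dmx d (B : rp beta) (M : frm) (V : rp d) := lmx (dmap B M V).

Definition isker d (B : rp beta) (M : frm) (V : rp d) (f : hom0 d) :=
  (forall a, f (qhead a) *m B a = V a *m f (qtail a)) /\ (forall x, f x *m M x = 0).

Definition rk d (B : rp beta) (M : frm) (V : rp d) := \rank (Dmx B M V).

Definition N0 d := #|fidx d beta|.
Definition N1 d := #|fidx (tgt_row d) tgt_col|.

Lemma dmap_linF d B M (V : rp d) : linF (dmap B M V).
Proof.
move=> c f g; apply: fam_ext => -[a|x]; rewrite /dmap /flin /=.
  by rewrite mulmxDl mulmxDr -scalemxAl -scalemxAr opprD addrACA -scalerBr.
by rewrite mulmxDl -scalemxAl.
Qed.

Lemma Dmx_lin d B M (V : rp d) B' M' V' c :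
  Dmx (flin c B' B) (flin c M' M) (flin c V' V) = Dmx B M V + c *: Dmx B' M' V'.
Proof.
rewrite -lmx_lin; apply: lmx_eq => f; apply: fam_ext => -[a|x]; rewrite /dmap /flin /=.
  by rewrite mulmxDl mulmxDr -scalemxAl -scalemxAr opprD addrACA -scalerBr.
by rewrite mulmxDr -scalemxAr.
Qed.

Lemma isker_Dmx d B M (V : rp d) f : isker B M V f <-> vec f *m Dmx B M V = 0.
Proof.
rewrite vec_lmx ?vec_eq0; last exact: dmap_linF.
split=> [[E1 E2] [a|x]|E]; rewrite /dmap ?E1 ?E2 ?subrr //.
by split=> [a|x]; [apply/eqP; rewrite -subr_eq0; exact/eqP/(E (inl a))|exact: (E (inr x))].
Qed.

Lemma Dmx_reg d (B : K -> rp beta) (M : K -> frm) (V : K -> rp d) :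
  regF B -> regF M -> regF V -> regM (fun t => Dmx (B t) (M t) (V t)).
Proof.
move=> HB HM HV; apply: (lmx_reg (fun t => dmap (B t) (M t) (V t))) => f [a|x] /=.
  by apply: regM_sub; apply: regM_mul => //; exact: regM_const.
by apply: regM_mul => //; exact: regM_const.
Qed.

Lemma regF_const (I : finType) (m n : I -> nat) (f : fam K m n) : regF (fun=> f).
Proof. by move=> i; exact: regM_const. Qed.

Lemma rk_ev d (B : K -> rp beta) (M : K -> frm) (V : K -> rp d) r :
  regF B -> regF M -> regF V -> (r <= rk (B 0%R) (M 0%R) (V 0%R))%N ->
  ev (fun t => (r <= rk (B t) (M t) (V t))%N).
Proof.
move=> HB HM HV le; have [+ _] := rank_kernel_curve (Dmx_reg HB HM HV).
by apply: ev_imp => t; exact: leq_trans.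
Qed.

Lemma ker_curve d (B : K -> rp beta) (M : K -> frm) (V : K -> rp d) f :
  regF B -> regF M -> regF V ->
  ev (fun t => (rk (B t) (M t) (V t) <= rk (B 0%R) (M 0%R) (V 0%R))%N) ->
  isker (B 0) (M 0) (V 0) f ->
  exists g, [/\ regF g, g 0 = f & ev (fun t => isker (B t) (M t) (V t) (g t))].
Proof.
move=> HB HM HV Hr /isker_Dmx Hf.
have [_ /(_ Hr _ _ Hf)[w [Hw w0 Ew]]] := rank_kernel_curve (Dmx_reg HB HM HV).
exists (fun t => unvec (w t)); split.
- move=> i p q; apply: reg_ext (Hw 0 (enum_rank (Tagged _ (p, q)))) => t.
  by rewrite mxE.
- by rewrite w0 vecK.
- by apply: ev_imp Ew => t E; apply/isker_Dmx; rewrite unvecK.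
Qed.

Definition post (d c : vertex Q -> nat) (p : fam K c d) (f : hom0 d) : hom0 c :=
  fun x => p x *m f x.
Definition post1 (d c : vertex Q -> nat) (p : fam K c d) (f : hom1 d) : hom1 c :=
  fun i => match i return 'M[K]_(tgt_row d i, tgt_col i) -> 'M[K]_(tgt_row c i, tgt_col i) with
           | inl a => fun y => p (qhead a) *m y
           | inr x => fun y => p x *m y end (f i).

Lemma post_linF d c (p : fam K c d) : linF (post p).
Proof. by move=> k f g; apply: fam_ext => x; rewrite /post /flin mulmxDr scalemxAr. Qed.

Lemma post1_linF d c (p : fam K c d) : linF (post1 p).
Proof.
by move=> k f g; apply: fam_ext => -[a|x]; rewrite /post1 /flin mulmxDr scalemxAr.
Qed.

Definition ishom d c (V : rp d) (C : rp c) (p : fam K c d) :=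
  forall a, p (qhead a) *m V a = C a *m p (qtail a).

Lemma Dmx_post d c B M (V : rp d) (C : rp c) p : ishom V C p ->
  Dmx B M V *m lmx (post1 p) = lmx (post p) *m Dmx B M C.
Proof.
move=> hp; rewrite !lmx_comp; [|exact: post_linF|exact: dmap_linF|exact: dmap_linF|exact: post1_linF].
apply: lmx_eq => f; apply: fam_ext => -[a|x]; rewrite /dmap /post /post1 /=.
  by rewrite mulmxBr !mulmxA hp.
by rewrite mulmxA.
Qed.

Definition linv (d c : vertex Q -> nat) (s : fam K d c) (p : fam K c d) := forall x, p x *m s x = 1%:M.

Lemma lmx_post1_inv d c (s : fam K d c) p : linv s p ->
  lmx (post1 s) *m lmx (post1 p) = 1%:M.
Proof.
move=> ps; rewrite lmx_comp; [|exact: post1_linF|exact: post1_linF].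
rewrite -lmx_id; apply: lmx_eq => f; apply: fam_ext => -[a|x]; rewrite /post1;
 by rewrite mulmxA ps mul1mx.
Qed.

Lemma lmx_post_inv d c (s : fam K d c) p : linv s p ->
  lmx (post s) *m lmx (post p) = 1%:M.
Proof.
move=> ps; rewrite lmx_comp; [|exact: post_linF|exact: post_linF].
by rewrite -lmx_id; apply: lmx_eq => f; apply: fam_ext => x; rewrite /post mulmxA ps mul1mx.
Qed.

(* The cokernel of [dmap] maps onto the one for a quotient of [V]. *)
Lemma coker_quot_le d c B M (V : rp d) (C : rp c) s p : ishom V C p -> linv s p ->
  (N1 c + rk B M V <= N1 d + rk B M C)%N.
Proof.
move=> hp ps; have rp1 : \rank (lmx (post1 p)) = N1 c.
  by apply/rank_left_inv; exists (lmx (post1 s)); exact: lmx_post1_inv.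
have := mxrank_mul_ker (Dmx B M V) (lmx (post1 p)).
have : (\rank (Dmx B M V *m lmx (post1 p)) <= rk B M C)%N.
  by rewrite (Dmx_post _ _ hp); exact: mxrankM_maxr.
have : (\rank (Dmx B M V :&: kermx (lmx (post1 p))) <= N1 d - N1 c)%N.
  by rewrite -rp1 -mxrank_ker mxrankS // capmxSr.
have : (N1 c <= N1 d)%N by rewrite -rp1 rank_leq_row.
move=> h1 h2 h3; rewrite /rk => <-.
exact: leq_add_subn h1 h2 h3.
Qed.

(* At maximal rank, conversely, no dimension of [coker dmap] is lost in passing to
   the cokernel of a morphism [f : B -> V]: by [first_order_kernel] the elements
   with values in the image of [f] are already in the image of [dmap]. *)
Lemma coker_max_le d c B M (V : rp d) (C : rp c) s p f y :
  (forall B' M', (rk B' M' V <= rk B M V)%N) -> isker B M V f ->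
  ishom V C p -> linv s p -> (forall x, 1%:M = s x *m p x + f x *m y x) ->
  (N1 d + rk B M C <= N1 c + rk B M V)%N.
Proof.
move=> Hmax kf hp ps E; have rp1 : \rank (lmx (post1 p)) = N1 c.
  by apply/rank_left_inv; exists (lmx (post1 s)); exact: lmx_post1_inv.
have := mxrank_mul_ker (Dmx B M V) (lmx (post1 p)).
have : (rk B M C <= \rank (Dmx B M V *m lmx (post1 p)))%N.
  rewrite (Dmx_post _ _ hp) eqmxMfull //.
  by apply/row_fullP; exists (lmx (post s)); exact: lmx_post_inv.
have : (kermx (lmx (post1 p)) <= Dmx B M V)%MS.
  apply/rV_subP => v; rewrite sub_kermx mul_lmx; last exact: post1_linF.
  move=> /eqP /vec_eq0 pv; set h := unvec v.
  (* Because [p h = 0], one has [h = f y h]: deforming [(B, M)] in the direction [y h] changes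
     [dmap B M V f] to first order by [h]. *)
  pose B' : rp beta := fun a => y (qhead a) *m h (inl a).
  pose M' : frm := fun x => y x *m h (inr x).
  have -> : v = vec f *m Dmx B' M' (fun a => 0 : 'M[K]_(d (qhead a), d (qtail a))).
    rewrite vec_lmx; last exact: dmap_linF.
    rewrite -[v]unvecK -/h; congr vec; apply: fam_ext => -[a|x]; rewrite /dmap.
      have := pv (inl a); rewrite /post1 -/h => pv0.
      by rewrite mul0mx subr0 mulmxA -[LHS]mul1mx E mulmxDl -(mulmxA (s _)) pv0 mulmx0 add0r.
    have := pv (inr x); rewrite /post1 -/h => pv0.
    by rewrite mulmxA -[LHS]mul1mx E mulmxDl -(mulmxA (s _)) pv0 mulmx0 add0r.
  apply: first_order_kernel; last exact/isker_Dmx.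
  move=> t; rewrite -Dmx_lin (_ : flin t _ V = V) ?Hmax //.
  by apply: fam_ext => a; rewrite /flin scaler0 add0r.
move=> sub; rewrite (capmx_idPr sub) mxrank_ker rp1.
have h : (N1 c <= N1 d)%N by rewrite -rp1 rank_leq_row.
move=> h1; rewrite -[\rank (Dmx B M V)]/(rk B M V) => <-.
by rewrite addnCA subnKC // addnC leq_add2r.
Qed.

End Fixed.
End Core.

(** * Liftable quotients of a generic representation *)

Section CoreTheorem.
Variables (K : numFieldType) (Q : quiver).

Notation rp d := (fam K (fun a : arrow Q => d (qhead a)) (fun a : arrow Q => d (qtail a))).
Implicit Types c d : vertex Q -> nat.

(* A quotient [p : V -> C] that extends along every rational curve through [V];
   this replaces its being defined over the field of rational functions. *)
Definition lquot d (V : rp d) c (C : rp c) (p : fam K c d) :=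
  [/\ forall x, \rank (p x) = c x, ishom V C p
    & forall W : K -> rp d, regF W -> W 0 = V ->
      exists (p' : K -> fam K c d) (C' : K -> rp c),
        [/\ regF p', regF C', p' 0 = p, C' 0 = C & ev (fun t => ishom (W t) (C' t) (p' t))]].

Lemma right_inv_fam c d (p : fam K c d) :
  (forall x, \rank (p x) = c x) -> exists s : fam K d c, linv s p.
Proof.
move=> rkp; apply: (@fin_all_exists _ _ (fun x s => p x *m s = 1%:M)) => x.
exact/rank_right_inv.
Qed.

Section Fixed.
Variables (beta mu : vertex Q -> nat).
Notation frm := (fam K beta mu).
Notation hom0 d := (fam K (d : vertex Q -> nat) beta).

(** Since the rank of the complex does not rise along [W], [f] extends to a curve of kernel
    elements. Its ranks cannot drop near 0, and the maximality of their sum keeps each of them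
    constant; therefore the cokernel of [f] extends too. *)
Lemma coker_curve d c (B : rp beta) (M : frm) (W : K -> rp d) (f : hom0 d)
    (p : fam K c d) (C : rp c) :
  regF W ->
  ev (fun t => (rk B M (W t) <= rk B M (W 0%R))%N) ->
  ev (fun t => forall g, isker B M (W t) g ->
     (\sum_x \rank (g x) <= \sum_x \rank (f x))%N) ->
  isker B M (W 0) f -> (forall x, c x + \rank (f x) = d x)%N ->
  (forall x, p x *m f x = 0) -> (forall x, \rank (p x) = c x) -> ishom (W 0) C p ->
  exists (f' : K -> hom0 d) (p' : K -> fam K c d) (C' : K -> rp c),
    [/\ [/\ regF f', regF p' & regF C'], [/\ f' 0 = f, p' 0 = p & C' 0 = C]
      & ev (fun t => [/\ isker B M (W t) (f' t), (forall x, \rank (f' t x) = \rank (f x)),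
           (forall x, p' t x *m f' t x = 0), (forall x, \rank (p' t x) = c x)
           & ishom (W t) (C' t) (p' t)])].
Proof.
move=> HW Hrk Hmax kf dE pf rkp hp.
have [f' [Hf' f'0 kf']] := ker_curve (regF_const B) (regF_const M) HW Hrk kf.
have rf'_ge : ev (fun t => forall x, (\rank (f x) <= \rank (f' t x))%N).
  apply: ev_all => x; rewrite -{1}f'0.
  by have [] := rank_kernel_curve (Hf' x).
have rf' : ev (fun t => forall x, \rank (f' t x) = \rank (f x)).
  apply: ev_imp (ev_and rf'_ge (ev_and Hmax kf')) => t [ge [mx k]] x.
  apply/eqP; rewrite eqn_leq ge andbT leqNgt; apply/negP => lt.
  have := mx _ k; rewrite leqNgt => /negP; apply.
  rewrite (bigD1 x) //= [X in (_ < X)%N](bigD1 x) //=.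
  by rewrite -addSn leq_add // leq_sum.
have [p1 Hp1] : exists p1 : forall x, K -> 'M[K]_(c x, d x), forall x,
    [/\ regM (p1 x), p1 x 0 = p x & ev (fun t => p1 x t *m f' t x = 0)].
  apply: (@fin_all_exists _ _ (fun x p1 => [/\ regM p1, p1 0 = p x & ev (fun t => p1 t *m f' t x = 0)])) => x.
  have [_] := rank_kernel_curve (Hf' x).
  rewrite f'0; apply; last exact: pf.
  by apply: ev_imp rf' => t /(_ x) ->.
pose p' t : fam K c d := fun x => p1 x t.
have Hp' : regF p' by move=> x; have [] := Hp1 x.
have p'0 : p' 0 = p by apply: fam_ext => x; have [] := Hp1 x.
have pf' : ev (fun t => forall x, p' t x *m f' t x = 0).
  by apply: ev_all => x; have [] := Hp1 x.
have rp' : ev (fun t => forall x, \rank (p' t x) = c x).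
  apply: ev_all => x; have [+ _] := rank_kernel_curve (Hp' x).
  rewrite p'0 rkp; apply: ev_imp => t ge; apply/eqP.
  by rewrite eqn_leq ge rank_leq_row.
have [s sp] := right_inv_fam rkp.
have Hps x : regM (fun t => p' t x *m s x).
  by apply: regM_mul; [exact: Hp'|exact: regM_const].
have U0 x : p' 0 x *m s x \in unitmx by rewrite p'0 sp unitmx1.
(* Near 0 the product [p' t s] is invertible, and [s] times its inverse is a section of [p' t]; the
   structure maps of the quotient are read off through it. *)
pose C' t : rp c := fun a => p' t (qhead a) *m W t a *m s (qtail a)
   *m invmx (p' t (qtail a) *m s (qtail a)).
exists f', p', C'; split.
- split=> // a; have Hi := regM_inv (Hps (qtail a)) (U0 (qtail a)).
  exact (regM_mul (regM_mul (regM_mul (Hp' (qhead a)) (HW a)) (regM_const (s (qtail a)))) Hi).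
- split=> //; apply: fam_ext => a.
  by rewrite /C' p'0 hp -(mulmxA (C a)) !sp invmx1 !mulmx1.
have U : ev (fun t => forall x, p' t x *m s x \in unitmx).
  by apply: ev_all => x; exact: unitmx_ev (Hps x) (U0 x).
apply: ev_imp (ev_and U (ev_and (ev_and kf' rf') (ev_and pf' rp'))).
move=> t [Ut [[kt rft] [pft rpt]]]; split=> // a; rewrite /C'.
set i := invmx _.
have [|||z zE] := @exact_lift _ _ _ _ _ (p' t (qtail a)) (f' t (qtail a)) (1%:M - s (qtail a) *m i *m p' t (qtail a)).
- exact: pft.
- by rewrite rft rpt dE.
- by rewrite mulmxBr mulmx1 !mulmxA mulmxV ?mul1mx ?subrr.
have : p' t (qhead a) *m W t a *m (1%:M - s (qtail a) *m i *m p' t (qtail a)) = 0.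
  by rewrite zE -mulmxA (mulmxA (W t a)) -kt.1 !mulmxA pft !mul0mx.
by rewrite mulmxBr mulmx1 !mulmxA => /eqP; rewrite subr_eq0 => /eqP.
Qed.

Definition vtot (d : vertex Q -> nat) := (\sum_x d x)%N.

Lemma coker_fam d b (f : fam K d b) c : (forall x, c x = d x - \rank (f x))%N ->
  exists (p : fam K c d) (s : fam K d c) (y : fam K b d),
    [/\ linv s p, (forall x, p x *m f x = 0) & forall x, 1%:M = s x *m p x + f x *m y x].
Proof.
move=> cE.
have [|psy H] := @fin_all_exists _ (fun x => ('M[K]_(c x, d x) * 'M[K]_(d x, c x) * 'M[K]_(b x, d x))%type)
  (fun x psy => [/\ psy.1.1 *m psy.1.2 = 1%:M, psy.1.1 *m f x = 0
     & 1%:M = psy.1.2 *m psy.1.1 + f x *m psy.2]) _.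
  by move=> x; rewrite cE; have [p [s [y H]]] := coker_data (f x); exists (p, s, y).
by exists (fun x => (psy x).1.1), (fun x => (psy x).1.2), (fun x => (psy x).2); split=> x; case: (H x).
Qed.

Lemma coker_rep d b c (B : rp b) (V : rp d) (f : fam K d b) p s y :
  ishom B V f -> linv s p -> (forall x, p x *m f x = 0) ->
  (forall x, 1%:M = s x *m p x + f x *m y x) ->
  ishom V (fun a => p (qhead a) *m V a *m s (qtail a) : 'M[K]_(c _, c _)) p.
Proof.
move=> hf sp pf E a.
have {1}-> : V a = V a *m (s (qtail a) *m p (qtail a) + f (qtail a) *m y (qtail a)).
  by rewrite -E mulmx1.
by rewrite !mulmxDr !mulmxA -(mulmxA _ (V a) (f _)) -hf mulmxA pf !mul0mx addr0.
Qed.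

(* Moving [C] to [C1] on a line moves [V] on a line of representations that keep
   [f] as a morphism and have the moving [C] as its cokernel. *)
Lemma coker_rank_bound d c e (B : rp beta) (M : frm) (V : rp d) (f : hom0 d) p s y (C C1 : rp c) :
  (forall (B' : rp beta) (M' : frm) (V' : rp d), (rk B' M' V' <= rk B M V)%N) ->
  (rk B M V + e <= N1 beta mu d)%N ->
  isker B M V f -> linv s p -> (forall x, p x *m f x = 0) ->
  (forall x, 1%:M = s x *m p x + f x *m y x) -> ishom V C p ->
  (rk B M C1 + e <= N1 beta mu c)%N.
Proof.
move=> Hmax Hd kf sp pf E hp.
pose U (D : rp c) : rp d := fun a => s (qhead a) *m D a *m p (qtail a).
pose C' t : rp c := flin t (flin (-1) C C1) C.
pose W t : rp d := flin t (U (flin (-1) C C1)) V.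
have HW : regF W by exact: regF_line.
have hW t : ishom (W t) (C' t) p.
  move=> a; rewrite /W /C' /flin /U mulmxDr mulmxDl hp -scalemxAr -scalemxAl.
  by rewrite !mulmxA sp mul1mx.
have kW t : isker B M (W t) f.
  split=> [a|]; last exact: kf.2.
  by rewrite kf.1 /W /flin /U mulmxDl -scalemxAl -!mulmxA pf !mulmx0 scaler0 add0r.
have e0 : ev (fun t => (rk B M V <= rk B M (W t))%N).
  by apply: (rk_ev (regF_const B) (regF_const M) HW); rewrite /W flin0.
have e1 : ev (fun t => (rk B M C1 <= rk B M (fseg C1 C t))%N).
  by apply: (rk_ev (regF_const B) (regF_const M) (regF_line _ _)); rewrite flin0.
have [t [h0 h1]] := ev_pick e0 e1.
have Ct : fseg C1 C (1 - t) = C' t by rewrite fseg_rev.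
rewrite Ct in h1.
have hle : (N1 beta mu d + rk B M (C' t) <= N1 beta mu c + rk B M (W t))%N.
  apply: (coker_max_le _ (kW t) (hW t) sp E) => B' M'.
  by apply: leq_trans h0; exact: Hmax.
have := Hmax B M (W t); move: h0 h1 hle Hd.
move: (rk B M (W t)) (rk B M (C' t)) (rk B M V) (rk B M C1) (N1 _ _ d) (N1 _ _ c).
move=> *; lia.
Qed.

(** Induction on the total dimension. If the complex is injective for some triple, then
    [N0 + e <= N1] holds in dimension [d] and every representation serves as its own quotient.
    Otherwise take a triple of maximal rank and a kernel element [f] of maximal total rank; it is
    nonzero, so its cokernel has smaller dimension, and a liftable quotient of the cokernel is one
    of [V]. *)
Theorem generic_lquot n d e : (vtot d < n)%N ->
  (forall (B : rp beta) (M : frm) (V : rp d), (rk B M V + e <= N1 beta mu d)%N) ->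
  exists O : rp d -> Prop,
    [/\ openF O, (exists V, O V) & forall V, O V ->
      exists c (C : rp c) (p : fam K c d), lquot V C p /\ (N0 beta c + e <= N1 beta mu c)%N].
Proof.
elim: n d => // n IH d dn Hrk.
case: (classic (exists (B : rp beta) (M : frm) (V : rp d), rk B M V = N0 beta d)) => [[B [M [V rE]]]|Hno].
  exists (fun _ => True); split=> [w _ _||V' _]; first exact: evT.
    by exists V.
  exists d, V', (fun x => 1%:M); split; last by rewrite -rE.
  split=> [x|a|W HW W0]; [by rewrite mxrank1|by rewrite mulmx1 mul1mx|].
  exists (fun t x => 1%:M), W; split=> //; first by move=> x; exact: regM_const.
  by apply: evT => t a; rewrite mulmx1 mul1mx.
pose T : Type := ((rp beta * frm) * rp d)%type.
have [||[[B0 M0] V0] [_ /= Hmax0]] := @ex_maximum T (fun _ => True) (fun z => rk z.1.1 z.1.2 z.2) (N1 beta mu d).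
- by exists ((fun a => 0, fun x => 0), fun a => 0).
- by move=> z _; exact: rank_leq_col.
set r := rk B0 M0 V0 in Hmax0.
have Hmax (B : rp beta) (M : frm) (V : rp d) : (rk B M V <= r)%N by exact: (Hmax0 ((B, M), V)).
pose S (z : T * hom0 d) := rk z.1.1.1 z.1.1.2 z.1.2 = r /\ isker z.1.1.1 z.1.1.2 z.1.2 z.2.
have [||[[[B M] V] f] [[/= rE kf] /= fmax]] := @ex_maximum _ S (fun z => \sum_x \rank (z.2 x))%N (vtot d).
- exists (((B0, M0), V0), fun x => 0); split=> //=.
  by split=> *; rewrite ?mulmx0 ?mul0mx.
- by move=> z _; apply: leq_sum => x _; exact: rank_leq_row.
have f_nz : exists x, f x != 0.
  have : kermx (Dmx B M V) != 0.
    rewrite kermx_eq0; apply/negP => /eqP fr; apply: Hno.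
    by exists B, M, V.
  case/rowV0Pn => v /sub_kermxP vD v0.
  have kg : isker B M V (unvec v) by apply/isker_Dmx; rewrite unvecK.
  apply: NNPP => H; have f0 x : f x = 0 by apply/eqP/negPn/negP => fx; apply: H; exists x.
  have := fmax (((B, M), V), unvec v) (conj rE kg).
  rewrite /= [X in (_ <= X)%N]big1 => [|x _]; last by rewrite f0 mxrank0.
  rewrite leqn0 sum_nat_eq0 => /forallP g0; case/eqP: v0.
  by rewrite -[v]unvecK; apply/vec_eq0 => x; apply/eqP; rewrite -mxrank_eq0; exact: (implyP (g0 x)).
pose c x := (d x - \rank (f x))%N.
have dE x : (c x + \rank (f x) = d x)%N by rewrite subnK // rank_leq_row.
have cn : (vtot c < n)%N.
  rewrite -ltnS; apply: leq_trans dn; rewrite ltnS /vtot.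
  have [x fx] := f_nz.
  rewrite (bigD1 x) //= [X in (_ < X)%N](bigD1 x) //= -addSn leq_add //.
    by rewrite -[X in (_ < X)%N](dE x) -[X in (X < _)%N]addn0 ltn_add2l lt0n mxrank_eq0.
  by apply: leq_sum => z _; exact: leq_subr.
have fmaxB (B' : rp beta) (M' : frm) (V' : rp d) (g : hom0 d) : rk B' M' V' = r -> isker B' M' V' g ->
    (\sum_x \rank (g x) <= \sum_x \rank (f x))%N.
  by move=> r' k'; have := fmax (((B', M'), V'), g) (conj r' k'); apply.
(* The defect [e] is inherited by dimension [c]. On the segment from [(B, M)] to [(B1, M1)], some
   point keeps the maximal rank and a deformation [g] of [f] with the ranks of [f], while its rank
   with [C1] is at least that of [(B1, M1)]; there [coker_rank_bound] applies. *)
have Hc (B1 : rp beta) (M1 : frm) (C1 : rp c) : (rk B1 M1 C1 + e <= N1 beta mu c)%N.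
  pose Bt := fseg B B1; pose Mt := fseg M M1.
  have HB : regF Bt by exact: regF_line.
  have HM : regF Mt by exact: regF_line.
  have Hr : ev (fun t => (r <= rk (Bt t) (Mt t) V)%N).
    by apply: (rk_ev HB HM (regF_const V)); rewrite /Bt /Mt !fseg0 rE.
  have Hr1 : ev (fun t => (rk B1 M1 C1 <= rk (fseg B1 B t) (fseg M1 M t) C1)%N).
    apply: (rk_ev (regF_line _ _) (regF_line _ _) (regF_const C1)); by rewrite !flin0.
  have [||g [Hg g0 kg]] := @ker_curve _ _ _ _ _ Bt Mt (fun=> V) f HB HM (regF_const V).
  - by apply: ev_imp Hr => t; rewrite /Bt /Mt !fseg0 rE => _; exact: Hmax.
  - by rewrite /Bt /Mt !fseg0.
  have gge : ev (fun t => forall x, (\rank (f x) <= \rank (g t x))%N).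
    by apply: ev_all => x; rewrite -g0; have [] := rank_kernel_curve (Hg x).
  have [t [[h0 [kt gt]] h1]] := ev_pick (ev_and Hr (ev_and kg gge)) Hr1.
  rewrite !fseg_rev -/(Bt t) -/(Mt t) in h1.
  have rt : rk (Bt t) (Mt t) V = r by apply/eqP; rewrite eqn_leq h0 Hmax.
  have gE x : \rank (g t x) = \rank (f x).
    have := fmaxB _ _ _ _ rt kt => le; apply/eqP; rewrite eqn_leq gt andbT.
    rewrite leqNgt; apply/negP => lt; move: le; rewrite leqNgt => /negP; apply.
    rewrite (bigD1 x) //= [X in (_ < X)%N](bigD1 x) //= -addSn leq_add //.
    by apply: leq_sum => z _.
  have [|p [s [y [sp pf E]]]] := @coker_fam _ _ (g t) c; first by move=> x; rewrite gE.
  apply: (leq_trans (leq_add h1 (leqnn e))).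
  apply: (@coker_rank_bound _ _ e (Bt t) (Mt t) V (g t) p s y _ C1) => //.
  - by move=> *; rewrite rt Hmax.
  - exact: coker_rep kt.1 sp pf E.
have [O3 [oO3 [C3 OC3] qO3]] := IH c cn Hc.
pose data (V' : rp d) (g : hom0 d) (p : fam K c d) (C : rp c) :=
  [/\ isker B M V' g, (forall x, \rank (g x) = \rank (f x)), (forall x, p x *m g x = 0),
      (forall x, \rank (p x) = c x) & ishom V' C p].
pose O (V' : rp d) := rk B M V' = r /\ exists g p C, data V' g p C /\ O3 C.
(* The extension along curves yields both the openness of [O] and the liftability of the composite
   quotient. *)
have lift (W : K -> rp d) g p C : regF W -> rk B M (W 0) = r -> data (W 0) g p C ->
    ev (fun t => rk B M (W t) = r) /\
    exists (g' : K -> hom0 d) (p' : K -> fam K c d) (C' : K -> rp c),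
    [/\ regF p', regF C', p' 0 = p, C' 0 = C & ev (fun t => data (W t) (g' t) (p' t) (C' t))].
  move=> HW r0 [kg rg pg rkp hp].
  have Er : ev (fun t => rk B M (W t) = r).
    have := rk_ev (r := r) (regF_const B) (regF_const M) HW.
    rewrite r0 leqnn => /(_ isT); apply: ev_imp => t ge; apply/eqP.
    by rewrite eqn_leq ge Hmax.
  split=> //.
  have [||x|g' [p' [C' [[_ Hp' HC'] [_ p'0 C'0] E]]]] := coker_curve HW _ _ kg _ pg rkp hp.
  - by apply: ev_imp Er => t ->; rewrite r0.
  - apply: ev_imp Er => t rt h kh; under [X in (_ <= X)%N]eq_bigr do rewrite rg.
    exact: fmaxB rt kh.
  - by rewrite rg.
  exists g', p', C'; split=> //; apply: ev_imp E => t [k1 k2 k3 k4 k5]; split=> // x.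
  by rewrite k2 rg.
exists O; split.
- move=> W HW [r0 [g [p [C [dW OC]]]]].
  have [Er [g' [p' [C' [Hp' HC' _ C'0 E]]]]] := lift W g p C HW r0 dW.
  have := oO3 C' HC'; rewrite C'0 => /(_ OC) EO.
  apply: ev_imp (ev_and Er (ev_and E EO)) => t [rt [dt Ot]]; split=> //.
  by exists (g' t), (p' t), (C' t).
- have [//|p [s [y [sp pf E]]]] := @coker_fam _ _ f c.
  pose C : rp c := fun a => p (qhead a) *m V a *m s (qtail a).
  have hp : ishom V C p by exact: coker_rep kf.1 sp pf E.
  (* For non-emptiness, the cokernel of [f] is moved towards [C3] along a line of representations
     that keep [f]; some point has rank [r] and cokernel in [O3]. *)
  pose U (D : rp c) : rp d := fun a => s (qhead a) *m D a *m p (qtail a).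
  pose W t : rp d := flin t (U (flin (-1) C C3)) V.
  have HW : regF W by exact: regF_line.
  have e0 : ev (fun t => (r <= rk B M (W t))%N).
    by apply: (rk_ev (regF_const B) (regF_const M) HW); rewrite /W flin0 rE.
  have e1 : ev (fun t => O3 (fseg C3 C t)).
    by apply: oO3; [exact: regF_line|rewrite fseg0].
  have [t [h0]] := ev_pick e0 e1; rewrite fseg_rev => h1.
  exists (W t); split; first by apply/eqP; rewrite eqn_leq h0 Hmax.
  exists f, p, (fseg C C3 t); split=> //; split=> //.
  + split=> [a|]; last exact: kf.2.
    by rewrite kf.1 /W /flin /U mulmxDl -scalemxAl -!mulmxA pf !mulmx0 scaler0 add0r.
  + by move=> x; apply/rank_right_inv; exists (s x).
  + move=> a; rewrite /W /fseg /flin /U mulmxDr mulmxDl hp -scalemxAr -scalemxAl.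
    by rewrite !mulmxA sp mul1mx.
- move=> V' [r0 [g [p [C [dW OC]]]]].
  have [c' [C' [p' [[rp' hp' lp'] Hc']]]] := qO3 C OC.
  exists c', C', (fun x => p' x *m p x); split=> //.
  case: (dW) => _ _ _ rkp hp; split.
  + move=> x; apply/rank_right_inv.
    have [s' sp'] := (rank_right_inv _).2 (rp' x); have [s sp] := (rank_right_inv _).2 (rkp x).
    by exists (s *m s'); rewrite mulmxA -(mulmxA (p' x)) sp mulmx1.
  + by move=> a; rewrite -mulmxA hp !mulmxA hp'.
  move=> W HW W0; rewrite -W0 in r0 dW.
  have [_ [g' [q [D [Hq HD q0 D0 E]]]]] := lift W g p C HW r0 dW.
  have [q' [D' [Hq' HD' q'0 D'0 E']]] := lp' D HD D0.
  exists (fun t x => q' t x *m q t x), D'; split=> //.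
  + by move=> x; exact: regM_mul (Hq' x) (Hq x).
  + by apply: fam_ext => x; rewrite q0 q'0.
  apply: ev_imp (ev_and E E') => t [[_ _ _ _ h] h'] a.
  by rewrite -mulmxA h !mulmxA h'.
Qed.

End Fixed.
End CoreTheorem.

(** * Subrepresentations, quotients, and weights as Euler characteristics *)

Section SubQuot.
Variables (K : numFieldType) (Q : quiver).
Notation rp d := (fam K (fun a : arrow Q => d (qhead a)) (fun a : arrow Q => d (qtail a))).
Implicit Types b c d u : vertex Q -> nat.

Definition isub d (V : rp d) u :=
  exists (B : rp u) (f : fam K d u), ishom B V f /\ forall x, \rank (f x) = u x.

Definition iquot d (V : rp d) c :=
  exists (C : rp c) (p : fam K c d), ishom V C p /\ forall x, \rank (p x) = c x.

Lemma ishom_comp b c d (B : rp b) (C : rp c) (V : rp d) (f : fam K c b) (g : fam K d c) :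
  ishom B C f -> ishom C V g -> ishom B V (fun x => g x *m f x).
Proof. by move=> hf hg a; rewrite -mulmxA hf !mulmxA hg. Qed.

Lemma hom_coker b d (B : rp b) (V : rp d) (f : fam K d b) : ishom B V f ->
  exists (C : rp (fun x => d x - \rank (f x))%N) (p : fam K (fun x => d x - \rank (f x))%N d)
    (s : fam K d (fun x => d x - \rank (f x))%N) (y : fam K b d),
    [/\ ishom V C p, linv s p, (forall x, p x *m f x = 0)
      & forall x, 1%:M = s x *m p x + f x *m y x].
Proof.
move=> hf; have [|p [s [y [sp pf E]]]] := @coker_fam _ _ _ _ f (fun x => d x - \rank (f x))%N.
  by [].
by exists (fun a => p (qhead a) *m V a *m s (qtail a)), p, s, y; split=> //; exact: coker_rep hf sp pf E.
Qed.

Lemma hom_ker b d (B : rp b) (V : rp d) (f : fam K d b) : ishom B V f ->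
  exists (N : rp (fun x => b x - \rank (f x))%N) (q : fam K b (fun x => b x - \rank (f x))%N)
    (r : fam K (fun x => b x - \rank (f x))%N b) (y : fam K b d),
    [/\ ishom N B q, linv q r, (forall x, f x *m q x = 0)
      & forall x, 1%:M = q x *m r x + y x *m f x].
Proof.
move=> hf; have [|z H] := @fin_all_exists _
  (fun x => ('M[K]_(b x, b x - \rank (f x)) * 'M[K]_(b x - \rank (f x), b x) * 'M[K]_(b x, d x))%type)
  (fun x z => [/\ z.1.2 *m z.1.1 = 1%:M, f x *m z.1.1 = 0
     & 1%:M = z.1.1 *m z.1.2 + z.2 *m f x]) _.
  by move=> x; have [q [r [y H]]] := ker_data (f x); exists (q, r, y).
exists (fun a => (z (qhead a)).1.2 *m B a *m (z (qtail a)).1.1).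
exists (fun x => (z x).1.1), (fun x => (z x).1.2), (fun x => (z x).2).
split; try by move=> x; case: (H x).
move=> a; have [_ fq E] := H (qhead a); have [_ fq' _] := H (qtail a).
have {2}-> : B a = ((z (qhead a)).1.1 *m (z (qhead a)).1.2 + (z (qhead a)).2 *m f (qhead a)) *m B a.
  by rewrite -E mul1mx.
by rewrite !mulmxDl -(mulmxA _ (f _)) hf -!mulmxA fq' !mulmx0 addr0.
Qed.

Lemma isub_le d (V : rp d) u x : isub V u -> (u x <= d x)%N.
Proof. by case=> B [f [_ <-]]; exact: rank_leq_row. Qed.

Lemma iquot_le d (V : rp d) u x : iquot V u -> (u x <= d x)%N.
Proof. by case=> B [f [_ <-]]; exact: rank_leq_col. Qed.

Lemma isub_quot d (V : rp d) u : isub V u -> iquot V (fun x => d x - u x)%N.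
Proof.
case=> B [f [hf rf]].
have <- : (fun x => d x - \rank (f x))%N = (fun x => d x - u x)%N.
  by apply: functional_extensionality => x; rewrite rf.
have [C [p [s [y [hp sp _ _]]]]] := hom_coker hf.
by exists C, p; split=> // x; apply/rank_right_inv; exists (s x).
Qed.

Lemma iquot_sub d (V : rp d) u : iquot V u -> isub V (fun x => d x - u x)%N.
Proof.
case=> C [p [hp rkp]].
have <- : (fun x => d x - \rank (p x))%N = (fun x => d x - u x)%N.
  by apply: functional_extensionality => x; rewrite rkp.
have [C' [q [r [y [hq rq _ _]]]]] := hom_ker hp.
by exists C', q; split=> // x; apply/rank_left_inv; exists (r x).
Qed.

Lemma isub_ker b d (B : rp b) (V : rp d) (f : fam K d b) : ishom B V f ->
  isub B (fun x => b x - \rank (f x))%N.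
Proof.
move=> hf; have [C' [q [r [y [hq rq _ _]]]]] := hom_ker hf.
by exists C', q; split=> // x; apply/rank_left_inv; exists (r x).
Qed.

Lemma iquot_coker b d (B : rp b) (V : rp d) (f : fam K d b) : ishom B V f ->
  iquot V (fun x => d x - \rank (f x))%N.
Proof.
move=> hf; have [C [p [s [y [hp sp _ _]]]]] := hom_coker hf.
by exists C, p; split=> // x; apply/rank_right_inv; exists (s x).
Qed.

Lemma isub_trans b d u (B : rp b) (V : rp d) (f : fam K d b) :
  ishom B V f -> (forall x, \rank (f x) = b x) -> isub B u -> isub V u.
Proof.
move=> hf rf [U [g [hg rg]]]; exists U, (fun x => f x *m g x); split.
  exact: ishom_comp hg hf.
move=> x; apply/rank_left_inv.
have [r1 E1] := (rank_left_inv _).2 (rf x); have [r2 E2] := (rank_left_inv _).2 (rg x).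
by exists (r2 *m r1); rewrite mulmxA -(mulmxA r2) E1 mulmx1.
Qed.

Lemma iquot_trans c d u (C : rp c) (V : rp d) (p : fam K c d) :
  ishom V C p -> (forall x, \rank (p x) = c x) -> iquot C u -> iquot V u.
Proof.
move=> hf rf [U [g [hg rg]]]; exists U, (fun x => g x *m p x); split.
  exact: ishom_comp hf hg.
move=> x; apply/rank_right_inv.
have [r1 E1] := (rank_right_inv _).2 (rf x); have [r2 E2] := (rank_right_inv _).2 (rg x).
by exists (r1 *m r2); rewrite mulmxA -(mulmxA (g x)) E1 mulmx1.
Qed.

(** The cokernel of the complex for [W] surjects onto the one for a quotient of dimension [c], which
    has dimension at least [N1 - N0] at [c]. This bounds the weights of all quotients from below. *)
Lemma iquot_openF_bound (beta mu : vertex Q -> nat) d (B : rp beta) (M : fam K beta mu) (V : rp d) :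
  exists O : rp d -> Prop, [/\ openF O, (exists V, O V) &
    forall W c, O W -> iquot W c -> (N1 beta mu c + rk B M V <= N1 beta mu d + N0 beta c)%N].
Proof.
exists (fun W => (rk B M V <= rk B M W)%N); split.
- by move=> W HW; apply: (rk_ev (regF_const B) (regF_const M) HW).
- by exists V.
move=> W c rW [C [p [hp /right_inv_fam[s sp]]]].
apply: leq_trans (leq_add (leqnn _) rW) _.
apply: leq_trans (coker_quot_le B M hp sp) _.
by rewrite leq_add2l; exact: rank_leq_row.
Qed.

Lemma card_fidx (I : finType) (m n : I -> nat) : #|fidx m n| = (\sum_i m i * n i)%N.
Proof.
rewrite card_tagged sumnE big_map big_enum /=.
by apply: eq_bigr => i _; rewrite card_prod !card_ord.
Qed.

Definition wval (sigma : weight Q) d : int := \sum_x sigma x * (d x)%:Z.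

Lemma theta_euler (beta : dimvec Q) (mu : vertex Q -> nat) d :
  (N0 beta d)%:Z - (N1 beta mu d)%:Z =
  wval (euler_weight (dimZ beta)) d - \sum_x (mu x)%:Z * (d x)%:Z.
Proof.
have -> : wval (euler_weight (dimZ beta)) d = euler (dimZ beta) (dimZ [ffun x => d x]).
  rewrite -((euler_weightP (dimZ beta) (euler_weight (dimZ beta))).2 erefl).
  by apply: eq_bigr => x _; rewrite !ffunE.
rewrite /N0 /N1 !card_fidx big_sumType /= PoszD opprD addrA /euler; congr (_ - _ - _).
- rewrite (big_morph Posz PoszD erefl); apply: eq_bigr => x _.
  by rewrite PoszM !ffunE mulrC.
- rewrite (big_morph Posz PoszD erefl); apply: eq_bigr => a _.
  by rewrite PoszM !ffunE mulrC.
- rewrite (big_morph Posz PoszD erefl); apply: eq_bigr => x _.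
  by rewrite PoszM mulrC.
Qed.

(** The number of vertices from which a given vertex is reachable grows along each arrow: a path
    from the head of an arrow back to its tail would close to an oriented cycle. *)
Lemma acyclic_rank : acyclic Q ->
  exists r : vertex Q -> nat, forall a : arrow Q, (r (qtail a) < r (qhead a))%N.
Proof.
move=> ac; pose e := [rel x y : vertex Q | [exists a : arrow Q, (qtail a == x) && (qhead a == y)]].
have arrows x p : path e x p -> exists s : seq (arrow Q),
    [/\ size s = size p, path.sorted [rel a b : arrow Q | qhead a == qtail b] s,
     (forall a0, s <> [::] -> qtail (head a0 s) = x) & forall a0, s <> [::] -> qhead (last a0 s) = last x p].
  elim: p x => [|y p IH] x /=; first by move=> _; exists [::].
  case/andP => /existsP[a /andP[/eqP ax /eqP ay]] /IH[s [sz ss hs ls]].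
  exists (a :: s); split=> //=; first by rewrite sz.
    case: s ss hs {sz ls} => //= b s ss hs.
    by rewrite (hs a) // ay eqxx.
  move=> _ _; case: s sz ss {hs} ls => [|b s] sz ss ls /=.
    by case: p {IH} sz {ls} => // _; rewrite ay.
  by apply: (ls a).
have noback a : ~~ connect e (qhead a) (qtail a).
  apply/negP => /connectP[p pth lst].
  have [s [sz ss hs ls]] := arrows _ _ pth.
  suff /ac : path.cycle [rel a b : arrow Q | qhead a == qtail b] (a :: s) by [].
  rewrite /= rcons_path; case: s sz ss hs ls => [|b s] sz ss hs ls /=.
    by move: lst; rewrite (size0nil (esym sz)) /= => ->; rewrite eqxx.
  rewrite (hs a) // eqxx /= [path _ _ _]ss /=.
  by have l := ls a; rewrite /= in l; rewrite l // -lst eqxx.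
exists (fun y => #|[set x | connect e x y]|) => a.
apply: proper_card; apply/properP; split.
  apply/subsetP => x; rewrite !inE => /connect_trans; apply; apply: connect1.
  by apply/existsP; exists a; rewrite !eqxx.
by exists (qhead a); rewrite !inE ?connect0 ?noback.
Qed.

(** [beta] grows so fast along arrows that [<beta, .>] dominates [sigma] at each vertex; the framing
    [mu] takes up the difference. *)
Lemma acyclic_weight (sigma : weight Q) : acyclic Q -> exists beta mu : vertex Q -> nat,
  forall d, wval sigma d = (N0 beta d)%:Z - (N1 beta mu d)%:Z.
Proof.
case/acyclic_rank => r rlt.
(* At most [D - 1] arrows enter a vertex of positive rank [r], each subtracting at most [S D^(r-1)]
   from [S D^r]; at least [S D^(r-1) >= S >= sigma] remains. *)
pose S := (\sum_x `|sigma x|)%N; pose D := #|arrow Q|.+1.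
pose beta : dimvec Q := [ffun x => (S * D ^ r x)%N].
have Hpos y : sigma y <= euler_weight (dimZ beta) y.
  have -> : euler_weight (dimZ beta) y = (beta y)%:Z - (\sum_(a | qhead a == y) beta (qtail a))%N%:Z.
    rewrite ffunE /euler (bigD1 y) //= big1 => [|x /negPf xy]; last by rewrite !ffunE xy mulr0.
    rewrite !ffunE eqxx mulr1 addr0; congr (_ - _).
    rewrite (big_morph Posz PoszD erefl) [RHS]big_mkcond; apply: eq_bigr => a _.
    by rewrite !ffunE; case: eqP => _; rewrite ?mulr1 ?mulr0.
  have sS : sigma y <= S%:Z.
    apply: le_trans (ler_norm _) _; rewrite -abszE lez_nat /S.
    by rewrite (bigD1 y) //= leq_addr.
  apply: le_trans sS _; rewrite lerBrDr -PoszD lez_nat ffunE.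
  case: (posnP (r y)) => [r0|rpos].
    rewrite r0 muln1 big1 ?addn0 // => a /eqP ay.
    by have := rlt a; rewrite ay r0.
  have le : (\sum_(a | qhead a == y) beta (qtail a) <= #|arrow Q| * (S * D ^ (r y).-1))%N.
    apply: (@leq_trans (\sum_(a | qhead a == y) S * D ^ (r y).-1)%N).
      apply: leq_sum => a /eqP ay; rewrite ffunE leq_mul2l leq_pexp2l ?orbT //.
      by rewrite -ltnS prednK // -ay rlt.
    by rewrite sum_nat_cond_const leq_mul2r max_card orbT.
  apply: leq_trans (leq_add (leqnn S) le) _.
  have -> : (S * D ^ r y = S * D ^ (r y).-1 + #|arrow Q| * (S * D ^ (r y).-1))%N.
    by rewrite -mulSn -/D mulnCA -expnS prednK.
  by rewrite leq_add2r -[X in (X <= _)%N]muln1 leq_mul2l expn_gt0 orbT.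
exists beta, (fun x => `|euler_weight (dimZ beta) x - sigma x|)%N => d.
rewrite theta_euler /wval -sumrB; apply: eq_bigr => x _.
by rewrite abszE ger0_norm ?subr_ge0 // mulrBl opprB addrC subrK.
Qed.

End SubQuot.

(** * Weights of quotients of a generic representation *)

Section Generic.
Variables (K : numFieldType) (Q : quiver).
Notation rp d := (fam K (fun a : arrow Q => d (qhead a)) (fun a : arrow Q => d (qtail a))).
Implicit Types b c d u : vertex Q -> nat.

Lemma lquot_iquot d (V : rp d) c (C : rp c) p : lquot V C p -> iquot V c.
Proof. by case=> rkp hp _; exists C, p. Qed.

(** Here [m = - e], with [e] the dimension of the cokernel at maximal rank: [generic_lquot] produces
    a quotient of weight at most [m], and [iquot_openF_bound] keeps all quotients at or above
    [m]. *)
Lemma generic_min_quot (sigma : weight Q) d : acyclic Q ->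
  exists (m : int) (O : rp d -> Prop), [/\ openF O, (exists V, O V) & forall V, O V ->
    (exists c (C : rp c) (p : fam K c d), lquot V C p /\ wval sigma c = m)
    /\ forall c, iquot V c -> m <= wval sigma c].
Proof.
move=> /(acyclic_weight sigma)[beta [mu sE]].
pose T : Type := ((rp beta * fam K beta mu) * rp d)%type.
have [||[[B M] V] [_ /= Hmax]] := @ex_maximum T (fun _ => True) (fun z => rk z.1.1 z.1.2 z.2) (N1 beta mu d).
- by exists ((fun a => 0, fun x => 0), fun a => 0).
- by move=> z _; exact: rank_leq_col.
have rN : (rk B M V <= N1 beta mu d)%N by exact: rank_leq_col.
pose e := (N1 beta mu d - rk B M V)%N.
have [O1 [oO1 nO1 qO1]] := @generic_lquot _ _ beta mu _ d e (ltnSn _) (fun B' M' V' =>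
  eq_ind _ (fun z => _ <= z)%N (leq_add (Hmax ((B', M'), V') I) (leqnn e)) _ (subnKC rN)).
have [O2 [oO2 nO2 qO2]] := iquot_openF_bound B M V.
exists (- e%:Z), (fun V => O1 V /\ O2 V); split.
- exact: openF_and.
- exact: openF_meet.
move=> W [/qO1[c [C [p [lq le]]]] OW].
have bd c' : iquot W c' -> - e%:Z <= wval sigma c'.
  by move=> /(qO2 _ _ OW); rewrite sE /e; move: rN; lia.
split=> //; exists c, C, p; split=> //; apply/eqP; rewrite eq_le bd ?andbT; last exact: lquot_iquot lq.
by rewrite sE; move: le; lia.
Qed.

(** [generic_lquot] with [e = 1]. By [semiinv_quot] such a quotient forces every semi-invariant of
    weight [sigma] to vanish at [V]. *)
Lemma generic_neg_quot (sigma : weight Q) (beta mu : vertex Q -> nat) d :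
  (forall c, wval sigma c = (N0 beta c)%:Z - (N1 beta mu c)%:Z) ->
  (forall (B : rp beta) (M : fam K beta mu) (V : rp d), (rk B M V < N1 beta mu d)%N) ->
  exists O : rp d -> Prop, [/\ openF O, (exists V, O V) & forall V, O V ->
    exists c, iquot V c /\ wval sigma c < 0].
Proof.
move=> sE Hrk.
have [|O [oO nO qO]] := @generic_lquot K _ beta mu _ d 1 (ltnSn _).
  by move=> B M V; rewrite addn1.
exists O; split=> // V /qO[c [C [p [lq le]]]]; exists c; split; first exact: lquot_iquot lq.
by rewrite sE; move: le; lia.
Qed.

End Generic.

(** * Determinants of group actions on families *)

Section Sylvester.
Variable K : numFieldType.

(** Sylvester's identity: both products of the block matrices [X] and [Y] are block triangular and
    have the same determinant. *)
Lemma det_1_mul m n (A : 'M[K]_(m, n)) (B : 'M_(n, m)) :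
  \det (1%:M + A *m B) = \det (1%:M + B *m A).
Proof.
pose X := block_mx 1%:M (- A) B 1%:M; pose Y := block_mx 1%:M A 0 (1%:M : 'M_n).
have detY : \det Y = 1 by rewrite det_ublock !det1 mulr1.
have : \det (Y *m X) = \det (X *m Y) by rewrite !det_mulmx mulrC.
have -> : Y *m X = block_mx (1%:M + A *m B) 0 B 1%:M.
  by rewrite mulmx_block !mul1mx !mulmx1 !mul0mx !add0r addNr.
have -> : X *m Y = block_mx 1%:M 0 B (1%:M + B *m A).
  by rewrite mulmx_block !mul1mx !mulmx1 !mulmx0 !addr0 subrr addrC.
by rewrite !det_lblock !det1 mul1r mulr1.
Qed.

Definition actF (I : finType) (m n : I -> nat) (G : forall i, 'M[K]_(m i)) (f : fam K m n) : fam K m n :=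
  fun i => G i *m f i.

Lemma actF_linF (I : finType) (m n : I -> nat) (G : forall i, 'M[K]_(m i)) :
  linF (@actF I m n G).
Proof. by move=> c f g; apply: fam_ext => i; rewrite /actF /flin mulmxDr scalemxAr. Qed.

Section DetAct.
Variables (I : finType) (m n : I -> nat) (G : forall i, 'M[K]_(m i)).
Let col_idx : finType := {i : I & 'I_(n i)}.

(* The action on the columns listed in [s] only. *)
Let act_cols (s : seq col_idx) (f : fam K m n) : fam K m n := fun i =>
  \matrix_(p, q) if (Tagged (fun i => 'I_(n i)) q : col_idx) \in s then (G i *m f i) p q else f i p q.

Let act_cols_linF s : linF (act_cols s).
Proof.
move=> c f g; apply: fam_ext => i; apply/matrixP => p q; rewrite !mxE.
case: ifP => // _; rewrite mulr_sumr -big_split; apply: eq_bigr => k _.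
by rewrite !mxE mulrDr mulrCA.
Qed.

(** With [S] selecting the coordinates of the column, the matrix is [1 + S (G - 1)^T S^T];
    Sylvester's identity reduces its determinant to size [m i]. *)
Let det_act_col (k : col_idx) : \det (lmx (act_cols [:: k])) = \det (G (tag k)).
Proof.
case: k => i q /=.
pose ix p : 'I_#|fidx m n| := enum_rank (Tagged (fun i => ('I_(m i) * 'I_(n i))%type) (p, q) : fidx m n).
pose S : 'M[K]_(#|fidx m n|, m i) := \matrix_(k, p) (k == ix p)%:R.
have ix_inj p p' : ix p = ix p' -> p = p'.
  by move=> /enum_rank_inj /eqP; rewrite -tag_eqE /tag_eq /= eqxx /= tagged_asE => /eqP[].
have SS : S^T *m S = 1%:M.
  apply/matrixP => p p'; rewrite !mxE (bigD1 (ix p)) //= ?mxE eqxx mul1r big1 ?addr0.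
    by rewrite (inj_eq ix_inj).
  by move=> k /negPf kp; rewrite ?mxE kp mul0r.
have vS v p : (v *m S) 0 p = (v 0 (ix p) : K).
  rewrite !mxE (bigD1 (ix p)) //= ?mxE eqxx mulr1 big1 ?addr0 // => k /negPf kp.
  by rewrite ?mxE kp mulr0.
have wS (w : 'rV_(m i)) p : (w *m S^T) 0 (ix p) = w 0 p.
  rewrite !mxE (bigD1 p) //= ?mxE eqxx mulr1 big1 ?addr0 // => z /negPf zp.
  by rewrite !mxE (inj_eq ix_inj) eq_sym zp mulr0.
have wS0 (w : 'rV_(m i)) l : (forall p, l <> ix p) -> (w *m S^T) 0 l = 0.
  move=> nl; rewrite mxE big1 // => p _; rewrite !mxE.
  by case: eqP => [/nl//|_]; rewrite mulr0.
have -> : lmx (act_cols [:: Tagged (fun i => 'I_(n i)) q]) = 1%:M + S *m ((G i - 1%:M)^T *m S^T).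
  apply/row_matrixP => k; rewrite rowK [RHS]rowE mulmxDr mulmx1 !mulmxA.
  set v : 'rV_(#|fidx m n|) := delta_mx 0 k; apply/rowP => l; rewrite [LHS]mxE [RHS]mxE.
  have El : l = enum_rank (enum_val l) by rewrite enum_valK.
  move: El; case: (enum_val l) => j [p' q'] El /=.
  rewrite [LHS]mxE inE; case: eqP => [E|E].
    have Ej : j = i by case: E.
    subst j; have {E} Eq : q' = q.
      by move/eqP: E; rewrite -tag_eqE /tag_eq /= eqxx /= tagged_asE => /eqP.
    rewrite Eq in El *; have -> : l = ix p' by [].
    rewrite wS linearB /= trmx1 mulmxBr mulmx1.
    have subE (A D : 'rV[K]_(m i)) : (A - D) 0 p' = A 0 p' - D 0 p' by rewrite !mxE.
    rewrite subE vS addrC subrK.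
    by rewrite !mxE; apply: eq_bigr => z _; rewrite vS !mxE mulrC.
  rewrite wS0 ?addr0; first by rewrite mxE El.
  rewrite El => p /enum_rank_inj E'; apply: E.
  exact (congr1 (fun z : fidx m n => Tagged (fun i => 'I_(n i)) (tagged z).2) E').
rewrite det_1_mul -mulmxA SS mulmx1 -det_tr linearD /= trmx1 trmxK addrC subrK //.
Qed.

(** The action is the product of its restrictions to single columns, and the index [i] contributes
    [n i] of these. *)
Lemma det_actF : \det (lmx (@actF I m n G)) = \prod_i \det (G i) ^+ n i.
Proof.
have comp k s : k \notin s -> lmx (act_cols s) *m lmx (act_cols [:: k]) = lmx (act_cols (k :: s)).
  move=> ks; rewrite lmx_comp; [|exact: act_cols_linF|exact: act_cols_linF].
  apply: lmx_eq => f; apply: fam_ext => i; apply/matrixP => p q; rewrite !mxE !inE.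
  case: eqP => [E|_] /=; last by [].
  by apply: eq_bigr => z _; rewrite mxE E (negPf ks).
have {comp} det s : uniq s -> \det (lmx (act_cols s)) = \prod_(k <- s) \det (G (tag k)).
  elim: s => [_|k s IH /andP[ks us]].
    rewrite big_nil -[RHS](det1 _ #|fidx m n|) -lmx_id; congr (\det _).
    by apply: lmx_eq => f; apply: fam_ext => i; apply/matrixP => p q; rewrite mxE.
  by rewrite -comp // det_mulmx det_act_col IH // big_cons mulrC.
have -> : lmx (@actF I m n G) = lmx (act_cols (enum col_idx)).
  apply: lmx_eq => f; apply: fam_ext => i; apply/matrixP => p q.
  by rewrite [RHS]mxE mem_enum.
rewrite det ?enum_uniq // big_enum /=.
rewrite -(sig_big_dep (fun=> true) (fun _ _ => true) (fun i (_ : 'I_(n i)) => \det (G i))) /=.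
by apply: eq_bigr => i _; rewrite prodr_const card_ord.
Qed.

End DetAct.
End Sylvester.

Section SquareDet.
Variable K : numFieldType.

(** The matrix of the complex is square only through an equation between its two sizes, along which
    it is cast. *)
Definition sqdet m n (e : m = n) (A : 'M[K]_(m, n)) : K := \det (castmx (e, erefl) A).

Lemma sqdet_mull m n (e : m = n) (G : 'M_m) (A : 'M[K]_(m, n)) :
  sqdet e (G *m A) = \det G * sqdet e A.
Proof. by case: _ / e A => A; rewrite /sqdet !castmx_id det_mulmx. Qed.

Lemma sqdet_mulr m n (e : m = n) (G : 'M_n) (A : 'M[K]_(m, n)) :
  sqdet e (A *m G) = sqdet e A * \det G.
Proof. by case: _ / e G A => G A; rewrite /sqdet !castmx_id det_mulmx. Qed.

Lemma sqdet_neq0 m n (e : m = n) (A : 'M[K]_(m, n)) :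
  (\rank A == n) = (sqdet e A != 0).
Proof.
case: _ / e A => A; rewrite /sqdet castmx_id -unitfE -unitmxE.
by rewrite -row_full_unit.
Qed.

End SquareDet.

(** * Polynomial functions and semi-invariants *)

Section SemiInvariants.
Variables (K : numFieldType) (Q : quiver).
Notation rp d := (fam K (fun a : arrow Q => d (qhead a)) (fun a : arrow Q => d (qtail a))).
Implicit Types b c d u : vertex Q -> nat.

Section Pol.
Variables (I : finType) (m n : I -> nat).

Definition polf (f : fam K m n -> K) : Prop :=
  exists p : {mpoly K[#|fidx m n|]}, forall V, f V = p.@[fun k => vec V 0 k].

Lemma polf_const (a : K) : polf (fun=> a).
Proof. by exists a%:MP => V; rewrite mevalC. Qed.

Lemma polf_add f g : polf f -> polf g -> polf (fun V => f V + g V).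
Proof. by move=> [p Ep] [q Eq]; exists (p + q) => V; rewrite mevalD Ep Eq. Qed.

Lemma polf_mul f g : polf f -> polf g -> polf (fun V => f V * g V).
Proof. by move=> [p Ep] [q Eq]; exists (p * q) => V; rewrite mevalM Ep Eq. Qed.

Lemma polf_ext f g : (forall V, f V = g V) -> polf f -> polf g.
Proof. by move=> E [p Ep]; exists p => V; rewrite -E Ep. Qed.

Lemma polf_opp f : polf f -> polf (fun V => - f V).
Proof.
by move=> /(polf_mul (polf_const (-1))); apply: polf_ext => V; rewrite mulN1r.
Qed.

Lemma polf_coord i p q : polf (fun V => V i p q).
Proof.
exists 'X_(enum_rank (Tagged (fun i => ('I_(m i) * 'I_(n i))%type) (p, q) : fidx m n)) => V.
by rewrite mevalXU mxE enum_rankK.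
Qed.

Lemma polf_sum (J : Type) (r : seq J) (P : pred J) (F : J -> fam K m n -> K) :
  (forall j, polf (F j)) -> polf (fun V => \sum_(j <- r | P j) F j V).
Proof.
move=> H; elim: r => [|i r IH].
  by apply: polf_ext (polf_const 0) => t; rewrite big_nil.
case Pi: (P i); last by apply: polf_ext IH => t; rewrite big_cons Pi.
by apply: polf_ext (polf_add (H i) IH) => t; rewrite big_cons Pi.
Qed.

Lemma polf_prod (J : Type) (r : seq J) (P : pred J) (F : J -> fam K m n -> K) :
  (forall j, polf (F j)) -> polf (fun V => \prod_(j <- r | P j) F j V).
Proof.
move=> H; elim: r => [|i r IH].
  by apply: polf_ext (polf_const 1) => t; rewrite big_nil.
case Pi: (P i); last by apply: polf_ext IH => t; rewrite big_cons Pi.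
by apply: polf_ext (polf_mul (H i) IH) => t; rewrite big_cons Pi.
Qed.

Lemma polf_det k (A : fam K m n -> 'M[K]_k) :
  (forall i j, polf (fun V => A V i j)) -> polf (fun V => \det (A V)).
Proof.
move=> HA; apply: polf_sum => s; apply: polf_mul; first exact: polf_const.
by apply: polf_prod => i; exact: HA.
Qed.

Lemma polf_reg f (W : K -> fam K m n) : polf f -> regF W -> reg (fun t => f (W t)).
Proof.
move=> [p Ep] HW.
have H : reg (fun t => \sum_(x <- msupp p) p@_x * \prod_k vec (W t) 0 k ^+ x k).
  apply: reg_sum => x; apply: reg_mul; first exact: reg_const.
  apply: reg_prod => k; elim: (x k) => [|e IH].
    by apply: reg_ext (reg_const 1) => t; rewrite expr0.
  apply: reg_ext (reg_mul (HW (tag (enum_val k)) (tagged (enum_val k)).1 (tagged (enum_val k)).2) IH) => t.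
  by rewrite exprS mxE.
by apply: reg_ext H => t; rewrite Ep mevalE.
Qed.

Lemma polf_openF f : polf f -> openF (fun V => f V != 0).
Proof. by move=> pf W HW; exact: reg_neq0 (polf_reg pf HW). Qed.

End Pol.

Definition semiinv d (sigma : weight Q) (f : rp d -> K) :=
  polf f /\ forall g : (forall x, 'M[K]_(d x)), (forall x, g x \in unitmx) ->
    forall V : rp d, f (fun a => invmx (g (qhead a)) *m V a *m g (qtail a)) =
    (\prod_x \det (g x) ^ sigma x) * f V.

Definition nzsemi d sigma := exists f : rp d -> K, semiinv sigma f /\ exists V, f V != 0.

Lemma prod_exprz (t : K) (sigma : weight Q) u : t != 0 ->
  \prod_x (t ^+ u x) ^ sigma x = t ^ wval sigma u.
Proof.
move=> t0; rewrite /wval; elim: (index_enum _) => [|x r IH].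
  by rewrite !big_nil expr0z.
by rewrite !big_cons IH expfzDr //; congr (_ * _); rewrite exprnP exprz_exp mulrC.
Qed.

Lemma det_scale_proj (d u : nat) (f : 'M[K]_(d, u)) r (t : K) : r *m f = 1%:M ->
  \det (1%:M + (t - 1) *: (f *m r)) = t ^+ u.
Proof.
move=> rf; rewrite scalemxAl det_1_mul -scalemxAr rf scalemx1 -raddfD.
by rewrite /= addrC subrK det_scalar.
Qed.

Lemma proj_scale_inv (d : nat) (p : 'M[K]_d) (t : K) : t != 0 -> p *m p = p ->
  (1%:M + (t^-1 - 1) *: p) *m (1%:M + (t - 1) *: p) = 1%:M.
Proof.
move=> t0 pp; rewrite mulmxDl !mulmxDr !mul1mx !mulmx1 -scalemxAl -scalemxAr pp.
by apply/matrixP => i j; rewrite !mxE; field.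
Qed.

(** The group element scales the image of [i] by [t^-1] and fixes the kernel of [r]. The projection
    [p = i r] onto a subrepresentation satisfies [p V p = V p], so the negative powers of [t] cancel
    and the orbit extends to [t = 0]. *)
Lemma semiinv_line d sigma (f : rp d -> K) u (i : fam K d u) (r : fam K u d) (B : rp u) (V : rp d) (t : K) :
  semiinv sigma f -> (forall x, r x *m i x = 1%:M) -> ishom B V i -> t != 0 ->
  f (flin (1 - t) (fun a => V a *m (i (qtail a) *m r (qtail a)) - (i (qhead a) *m r (qhead a)) *m V a) V)
    = (t^-1) ^ wval sigma u * f V.
Proof.
move=> [_ sf] ri hi t0.
pose p x := i x *m r x.
have pp x : p x *m p x = p x by rewrite /p mulmxA -(mulmxA (i x)) ri mulmx1.
have pV a : p (qhead a) *m V a *m p (qtail a) = V a *m p (qtail a).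
  by rewrite /p -!mulmxA (mulmxA (V a)) -hi !mulmxA -(mulmxA (i _) (r _)) ri mulmx1.
pose g x := 1%:M + (t^-1 - 1) *: p x.
have gi x : g x *m (1%:M + (t - 1) *: p x) = 1%:M by exact: (proj_scale_inv t0 (pp x)).
have gU x : g x \in unitmx by have [] := mulmx1_unit (gi x).
have ginv x : invmx (g x) = 1%:M + (t - 1) *: p x.
  by have := mulKmx (gU x) (1%:M + (t - 1) *: p x); rewrite gi mulmx1.
have := sf g gU V; rewrite -prod_exprz ?invr_eq0 //.
under eq_bigr do rewrite det_scale_proj //.
move=> <-; congr f; apply: fam_ext => a; rewrite ginv /g /flin -/(p _) -/(p _).
rewrite mulmxDl mul1mx mulmxDr mulmx1 !mulmxDl -!scalemxAl -!scalemxAr !pV.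
apply/matrixP => k l; rewrite !mxE; field; exact: t0.
Qed.

(** If the weight were [n > 0], then [f (W t) * t ^+ n = f V] for all nonzero [t], and the limit at
    0 would give [f V = 0]. *)
Lemma semiinv_sub d sigma (f : rp d -> K) (V : rp d) u :
  semiinv sigma f -> f V != 0 -> isub V u -> wval sigma u <= 0.
Proof.
move=> sf fV [B [i [hi ri']]].
have [r ri] : exists r : fam K u d, forall x, r x *m i x = 1%:M.
  apply: (@fin_all_exists _ _ (fun x r => r *m i x = 1%:M)) => x.
  exact/rank_left_inv.
rewrite leNgt; apply/negP => pos; case/eqP: fV.
case E: (wval sigma u) pos => [n|//]; rewrite ltz_nat => n0.
pose W (t : K) := flin (1 - t) (fun a => V a *m (i (qtail a) *m r (qtail a)) - (i (qhead a) *m r (qhead a)) *m V a) V.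
have HW : regF W.
  have H1 : reg (fun t : K => 1 - t) by apply: reg_add; [exact: reg_const|exact: reg_opp (@reg_id K)].
  by move=> a; exact: (regM_add (regM_scale H1 (regM_const _)) (regM_const _)).
have H : reg (fun t => f (W t) * t ^+ n - f V).
  apply: reg_add (reg_const _); apply: reg_mul; first exact: polf_reg sf.1 HW.
  by apply: reg_ext (reg_poly 'X^n) => t; rewrite hornerXn.
have : f (W 0) * 0 ^+ n - f V = 0.
  apply: (reg_eq0 H); apply: evT => t t0.
  rewrite (semiinv_line sf ri hi t0) E -exprnP exprVn mulrAC mulVf ?mul1r ?subrr //.
  by rewrite expf_neq0.
by rewrite expr0n eqn0Ngt n0 mulr0 sub0r => /eqP; rewrite oppr_eq0 => /eqP.
Qed.

(** With [V] as its own subrepresentation the curve of [semiinv_line] is constant; at [t = 2] the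
    factor must be 1, which determines the exponent. *)
Lemma semiinv_total d sigma (f : rp d -> K) (V : rp d) :
  semiinv sigma f -> f V != 0 -> wval sigma d = 0.
Proof.
move=> sf fV; apply/eqP.
have n2 : (2%:R : K) != 0 by rewrite pnatr_eq0.
have := @semiinv_line _ _ _ _ (fun x => 1%:M) (fun x => 1%:M) V V 2%:R sf (fun x => mul1mx _) _ n2.
have -> : flin (1 - 2%:R) (fun a => V a *m (1%:M *m 1%:M) - 1%:M *m 1%:M *m V a) V = V.
  by apply: fam_ext => a; rewrite /flin !mul1mx mulmx1 subrr scaler0 add0r.
move=> /(_ _)/eqP; rewrite -{1}[f V]mul1r => /(_ _)/eqP/(mulIf fV)/esym E.
have {E} : (2%:R : K)^-1 ^ wval sigma d = 1 by apply: E => a; rewrite mul1mx mulmx1.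
rewrite exprz_inv => /eqP.
have H n : ((2%:R : K) ^+ n == 1) = (n == 0)%N.
  by rewrite -natrX -[1]/(1%:R) eqr_nat -[X in _ == X](expn0 2) eqn_exp2l.
case: (wval sigma d) => n; first by rewrite -exprnN invr_eq1 H eqz_nat.
by rewrite NegzE opprK -exprnP H.
Qed.

Lemma semiinv_quot d sigma (f : rp d -> K) (V : rp d) c :
  semiinv sigma f -> f V != 0 -> iquot V c -> 0 <= wval sigma c.
Proof.
move=> sf fV qV; have := semiinv_sub sf fV (iquot_sub qV).
have -> : wval sigma (fun x => d x - c x)%N = wval sigma d - wval sigma c.
  rewrite /wval -sumrB; apply: eq_bigr => x _.
  by rewrite -mulrBr -subzn // (iquot_le x qV).
by rewrite (semiinv_total sf fV) sub0r oppr_le0.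
Qed.

(** The complex intertwines the actions of the group on its two terms, so its determinant is
    multiplied by the quotient of the determinants of these actions. *)
Lemma det_semiinv (beta mu : vertex Q -> nat) (sigma : weight Q) d
    (B : rp beta) (M : fam K beta mu) (V : rp d) :
  (forall c, wval sigma c = (N0 beta c)%:Z - (N1 beta mu c)%:Z) ->
  rk B M V = N1 beta mu d -> N0 beta d = N1 beta mu d -> nzsemi d sigma.
Proof.
move=> sE rkV e; exists (fun W => sqdet e (Dmx B M W)); split; last first.
  by exists V; rewrite -sqdet_neq0; apply/eqP.
split.
  apply: polf_det => k l.
  set k' := cast_ord (esym e) k.
  apply: (@polf_ext _ _ _ (fun W => dmap B M W (unvec (delta_mx 0 k')) (tag (enum_val l))
     (tagged (enum_val l)).1 (tagged (enum_val l)).2)).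
    by move=> W; rewrite castmxE /= cast_ord_id mxE [RHS]mxE.
  case: (enum_val l) => -[a|x] [p q] /=; last exact: polf_const.
  apply: (@polf_ext _ _ _ (fun W : rp d => (unvec (delta_mx 0 k') (qhead a) *m B a) p q
     - \sum_j W a p j * unvec (delta_mx 0 k') (qtail a) j q)).
    by move=> W; rewrite [RHS]mxE; congr (_ + _); rewrite [RHS]mxE; congr (- _); rewrite [RHS]mxE.
  apply: polf_add; first exact: polf_const.
  apply: polf_opp; apply: polf_sum => j; apply: polf_mul; last exact: polf_const.
  exact: polf_coord.
move=> g gU W.
pose W' : rp d := fun a => invmx (g (qhead a)) *m W a *m g (qtail a).
pose G1 (i : arrow Q + vertex Q) : 'M[K]_(tgt_row d i) :=
  match i with inl a => g (qhead a) | inr x => g x end.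
have E : lmx (@actF K _ d beta g) *m Dmx B M W = Dmx B M W' *m lmx (@actF K _ (tgt_row d) (tgt_col beta mu) G1).
  rewrite !lmx_comp; [|exact: dmap_linF|exact: actF_linF|exact: actF_linF|exact: dmap_linF].
  apply: lmx_eq => f; apply: fam_ext => -[a|x]; rewrite /dmap /actF /G1 /W' /=.
    by rewrite mulmxBr !mulmxA mulmxV // mul1mx.
  by rewrite mulmxA.
have := congr1 (sqdet e) E; rewrite sqdet_mull sqdet_mulr !det_actF /= big_sumType /=.
have gD x : \det (g x) != 0 by rewrite -unitfE -unitmxE.
(* Evaluation at unit dimension vectors identifies the exponent of [\det (g x)]. *)
have sx x : sigma x = (beta x)%:Z - (\sum_(a | qhead a == x) beta (qtail a) + mu x)%N%:Z.
  have := sE (fun z => (z == x)%N).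
  rewrite /wval (bigD1 x) //= eqxx mulr1 big1 ?addr0 => [->|z /negPf zx]; last by rewrite zx mulr0.
  rewrite /N0 /N1 !card_fidx big_sumType /=; congr (Posz _ - Posz (_ + _)).
  - rewrite (bigD1 x) //= eqxx mul1n big1 ?addn0 // => z /negPf zx; by rewrite zx.
  - rewrite [RHS]big_mkcond; apply: eq_bigr => a _; by case: eqP; rewrite ?mul1n.
  - rewrite (bigD1 x) //= eqxx mul1n big1 ?addn0 // => z /negPf zx; by rewrite zx.
have -> : \prod_a \det (g (qhead a)) ^+ beta (qtail a) =
    \prod_x \det (g x) ^+ (\sum_(a | qhead a == x) beta (qtail a)).
  rewrite (partition_big (fun a : arrow Q => qhead a) xpredT) //=; apply: eq_bigr => x _.
  rewrite -prodrXr; by apply: eq_bigr => a /eqP ->.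
rewrite -big_split /= => {E} E.
have E2 : \prod_x \det (g x) ^+ beta x = (\prod_x \det (g x) ^ sigma x) *
    \prod_x (\det (g x) ^+ (\sum_(a | qhead a == x) beta (qtail a)) * \det (g x) ^+ mu x).
  rewrite -big_split /=; apply: eq_bigr => x _.
  by rewrite -exprD !exprnP -expfzDr // sx subrK.
set c := \prod_x (_ * _) in E E2.
have c0 : c != 0 by apply/prodf_neq0 => x _; rewrite mulf_neq0 // expf_neq0.
by apply: (mulIf c0); rewrite -E E2; ring.
Qed.

End SemiInvariants.

(** * Transposition and duality along the involution *)

Section Retranspose.
Variable K : numFieldType.

(** Entries are indexed by plain numbers, with value 0 out of range, so that indices need no
    transport between sizes. *)
Definition nent m n (A : 'M[K]_(m, n)) (i j : nat) : K :=
  match insub i, insub j with Some i', Some j' => A i' j' | _, _ => 0 end.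

Lemma nentE m n (A : 'M[K]_(m, n)) (i : 'I_m) (j : 'I_n) : nent A i j = A i j.
Proof. by rewrite /nent !valK. Qed.

(* The transpose, cast to the expected size; it avoids explicit casts along the
   equalities between vertices satisfied by an involution. *)
Definition retr m n m' n' (A : 'M[K]_(m, n)) : 'M[K]_(m', n') :=
  \matrix_(i, j) nent A j i.

Lemma retrE m n (A : 'M[K]_(m, n)) : retr n m A = A^T.
Proof. by apply/matrixP => i j; rewrite !mxE nentE. Qed.

Lemma retr_rank m n m' n' (A : 'M[K]_(m, n)) : m' = n -> n' = m ->
  \rank (retr m' n' A) = \rank A.
Proof. by move=> -> ->; rewrite retrE mxrank_tr. Qed.

Lemma retr_mul m k p m' k' p' (A : 'M[K]_(m, k)) (B : 'M_(k, p)) :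
  m' = m -> k' = k -> p' = p ->
  retr p' m' (A *m B) = retr p' k' B *m retr k' m' A.
Proof. by move=> -> -> ->; rewrite !retrE trmx_mul. Qed.

Lemma retr_reg m n m' n' (A : K -> 'M[K]_(m, n)) : regM A -> regM (fun t => retr m' n' (A t)).
Proof.
move=> HA i j; case Ei: (insub (i : nat) : option 'I_n) => [i'|]; last first.
  apply: reg_ext (reg_const 0) => t; rewrite mxE /nent Ei.
  by case: insub.
case Ej: (insub (j : nat) : option 'I_m) => [j'|]; last first.
  by apply: reg_ext (reg_const 0) => t; rewrite mxE /nent Ej.
by apply: reg_ext (HA j' i') => t; rewrite mxE /nent Ei Ej.
Qed.

Lemma retr_fam (I : finType) (m n : I -> nat) (f : fam K m n) x y m' n' : x = y ->
  retr m' n' (f x) = retr m' n' (f y).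
Proof. by move=> ->. Qed.

Lemma retrK_fam (I : finType) (m n : I -> nat) (f : fam K m n) x y m' n' :
  x = y -> m' = n x -> n' = m x -> retr (m y) (n y) (retr m' n' (f x)) = f y.
Proof. by move=> -> -> ->; rewrite !retrE trmxK. Qed.

End Retranspose.

Section Duality.
Variables (K : numFieldType) (Q : quiver) (tau : involution Q).
Notation rp d := (fam K (fun a : arrow Q => d (qhead a)) (fun a : arrow Q => d (qtail a))).
Implicit Types b c d u : vertex Q -> nat.
Local Notation t0 := (inv0 tau).
Local Notation t1 := (inv1 tau).

(** The transposed maps represent the opposite quiver, which [tau] identifies with [Q];
    subrepresentations and quotients are exchanged. *)
Definition dual d (V : rp d) : rp (fun x => d (t0 x)) := fun a => retr _ _ (V (t1 a)).

Lemma dual_openF d (O : rp (fun x => d (t0 x)) -> Prop) : openF O -> openF (fun V : rp d => O (dual V)).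
Proof. by move=> oO W HW; apply: (oO (fun t => dual (W t))) => a; apply: retr_reg; exact: HW. Qed.

Lemma dual_surj d (W : rp (fun x => d (t0 x))) : exists V : rp d, dual V = W.
Proof.
exists (fun a => retr _ _ (W (t1 a))); apply: fam_ext => a; rewrite /dual.
apply: (retrK_fam (m := fun a => d (t0 (qhead a))) (n := fun a => d (t0 (qtail a))) W (inv1K tau a)).
  by rewrite inv1K head_inv1.
by rewrite inv1K tail_inv1.
Qed.

Lemma dual_sub_quot d (V : rp d) u : isub (dual V) u -> iquot V (fun x => u (t0 x)).
Proof.
case=> U [f [hf rf]]; exists (dual U), (fun x => retr _ _ (f (t0 x))); split; last first.
  by move=> x; rewrite retr_rank ?inv0K // rf.
move=> a; have /(congr1 (retr (u (t0 (qhead a))) (d (qtail a)))) := hf (t1 a).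
have eh : qhead (t1 a) = t0 (qtail a) by rewrite head_inv1.
have et : qtail (t1 a) = t0 (qhead a) by rewrite tail_inv1.
rewrite (@retr_mul _ _ _ _ _ (u (t0 (qtail a)))) ?eh ?et ?inv0K //.
rewrite (@retr_mul _ _ _ _ _ (d (qhead a))) ?eh ?et ?inv0K //.
rewrite (retr_fam (m := fun x => d (t0 x)) (n := u) f _ _ eh).
rewrite (retr_fam (m := fun x => d (t0 x)) (n := u) f _ _ et).
rewrite {1}/dual (@retrK_fam _ _ (fun a => d (qhead a)) (fun a => d (qtail a)) V _ a) ?inv1K ?eh ?et ?inv0K //.
Qed.

Lemma dual_quot_sub d (V : rp d) u : iquot V u -> isub (dual V) (fun x => u (t0 x)).
Proof.
case=> U [f [hf rf]]; exists (dual U), (fun x => retr _ _ (f (t0 x))); split; last first.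
  by move=> x; rewrite retr_rank.
move=> a; have /(congr1 (retr (d (t0 (qhead a))) (u (t0 (qtail a))))) := hf (t1 a).
have eh : qhead (t1 a) = t0 (qtail a) by rewrite head_inv1.
have et : qtail (t1 a) = t0 (qhead a) by rewrite tail_inv1.
rewrite (@retr_mul _ _ _ _ _ (d (t0 (qtail a)))) ?eh ?et //.
rewrite (@retr_mul _ _ _ _ _ (u (t0 (qhead a)))) ?eh ?et //.
rewrite (retr_fam (m := u) (n := d) f _ _ eh) (retr_fam (m := u) (n := d) f _ _ et).
by rewrite /dual => ->.
Qed.

End Duality.

(** Place values in base [b]: the weighted sum determines its digits one after the other, by
    reduction modulo [b]. *)
Lemma digit_weights (I : finType) (b : nat) : exists w : I -> nat,
  (forall x, 0 < w x)%N /\ forall u v : I -> nat, (forall x, u x < b)%N -> (forall x, v x < b)%N ->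
    (\sum_x w x * u x = \sum_x w x * v x)%N -> forall x, u x = v x.
Proof.
suff H (s : seq I) : uniq s -> exists w : I -> nat,
  (forall x, 0 < b -> 0 < w x)%N /\ forall u v : I -> nat, (forall x, u x < b)%N -> (forall x, v x < b)%N ->
    (\sum_(x <- s) w x * u x = \sum_(x <- s) w x * v x)%N -> forall x, x \in s -> u x = v x.
  case: b H => [|b] H.
    by exists (fun=> 1)%N; split=> // u v _ /[swap] _ /[swap] x /(_ x).
  have [w [wp wu]] := H _ (enum_uniq I); exists w; split; first by move=> x; exact: wp.
  move=> u v ub vb E x; apply: (wu u v ub vb); last by rewrite mem_enum.
  by rewrite !big_enum.
elim: s => [|y s IH] /=; first by exists (fun=> 1)%N.
case/andP => ys /IH[w [wp wu]]; exists (fun x => if x == y then 1 else b * w x)%N.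
split=> [x b0|u v ub vb]; first by case: ifP => // _; rewrite muln_gt0 b0 wp.
have red (f : I -> nat) : (\sum_(x <- y :: s) (if x == y then 1 else b * w x) * f x = f y + b * \sum_(x <- s) w x * f x)%N.
  rewrite big_cons eqxx mul1n; congr (_ + _)%N; rewrite big_distrr /= !big_seq.
  by apply: eq_bigr => x xs; case: eqP => [xy|_]; [rewrite xy (negPf ys) in xs|rewrite mulnA].
rewrite !red => E.
have b0 : (0 < b)%N by apply: leq_ltn_trans (ub y).
have Ey : u y = v y.
  by have := congr1 (modn^~ b) E; rewrite /= ![(_ + b * _)%N]addnC !(mulnC b) !modnMDl !modn_small.
move: E; rewrite Ey => /addnI/eqP; rewrite eqn_pmul2l // => /eqP E x.
by rewrite inE => /orP[/eqP->//|]; exact: (wu u v ub vb E).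
Qed.

(** * The destabilizing subrepresentation and its orthogonality *)

Section Unstable.
Variables (K : numFieldType) (Q : quiver).
Notation rp d := (fam K (fun a : arrow Q => d (qhead a)) (fun a : arrow Q => d (qtail a))).
Notation no_frame := (fun _ : vertex Q => 0%N).
Implicit Types b c d u : vertex Q -> nat.

Definition frame0 b : fam K b no_frame := fun x => 0.

(** The unframed complex of some pair is square and invertible, i.e. [Hom(B, C) = Ext(B, C) = 0]. *)
Definition perp b c := N0 b c = N1 b no_frame c /\
  exists (B : rp b) (C : rp c), rk B (frame0 b) C = N1 b no_frame c.

Lemma rk_inj b c (B : rp b) (C : rp c) :
  (forall h, ishom B C h -> forall x, h x = 0) -> rk B (frame0 b) C = N0 b c.
Proof.
move=> H; apply/eqP; rewrite -[_ == _]/(row_free _) -kermx_eq0; apply/rowV0Pn => -[v /sub_kermxP vD].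
case/eqP; rewrite -[v]unvecK; apply/vec_eq0; apply: H => a.
by have /isker_Dmx[E _] : vec (unvec v) *m Dmx B (frame0 b) C = 0 by rewrite unvecK.
Qed.

(* Every first-order deformation [X] of [V] lifts to the quotient, so its class
   in [Ext(B, C)] vanishes. *)
Lemma lquot_ext b c d (B : rp b) (C : rp c) (V : rp d) p f (r : fam K b d) s :
  lquot V C p -> ishom B V f -> linv s p -> linv f r -> (forall x, p x *m f x = 0) ->
  rk B (frame0 b) C = N1 b no_frame c.
Proof.
move=> [rkp hp lift] hf ps rf pf; apply/eqP; rewrite -[_ == _]/(row_full _) -sub1mx.
apply/row_subP => k; move: (row k 1%:M) => v {k}.
pose xi := unvec v.
(* A direction with [p X f = xi]; the line through [V] in this direction carries the class of
   [xi]. *)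
pose X : rp d := fun a => s (qhead a) *m xi (inl a) *m r (qtail a).
have [p' [C' [Hp' HC' p'0 C'0 E]]] := lift (fun t => flin t X V) (regF_line V X) (flin0 V X).
have [p1 Hp1] : exists p1 : forall x, K -> 'M[K]_(c x, d x), forall x,
    regM (p1 x) /\ ev (fun t => p' t x = p x + t *: p1 x t).
  apply: (@fin_all_exists _ _ (fun x p1 => regM p1 /\ ev (fun t => p' t x = p x + t *: p1 t))) => x.
  by have [q Hq Eq] := regM_quot (Hp' x); exists q; rewrite p'0 in Eq.
(* The first-order term of the lifted quotient map, restricted to [B], gives the preimage of
   [xi]. *)
pose psi : fam K c b := fun x => - (p1 x 0 *m f x).
apply/submxP; exists (vec psi); rewrite vec_lmx; last exact: dmap_linF.
rewrite -[v]unvecK -/xi; congr vec; apply: fam_ext => -[a|x]; last first.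
  by apply/matrixP => i [].
rewrite /dmap /psi mulNmx mulmxN opprK -mulmxA hf.
set x := qtail a; set y := qhead a.
(* The equation of the lifted morphism, composed with [f] and divided by [t]. *)
pose F t := p1 y t *m (V a *m f x) + p y *m X a *m f x + t *: (p1 y t *m X a *m f x)
  - C' t a *m (p1 x t *m f x).
have F0 : F 0 = 0.
  apply: regM_eq0.
    have Hp1' z := (Hp1 z).1.
    apply: regM_sub; last exact: (regM_mul (HC' a) (regM_mul (Hp1' x) (regM_const (f x)))).
    apply: regM_add.
      exact: (regM_add (regM_mul (Hp1' y) (regM_const _)) (regM_const _)).
    exact: (regM_scale (@reg_id K) (regM_mul (regM_mul (Hp1' y) (regM_const _)) (regM_const _))).
  have Ey := (Hp1 y).2; have Ex := (Hp1 x).2.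
  apply: ev_imp (ev_and E (ev_and Ex Ey)) => t [/(_ a) + [ex ey]] t0.
  rewrite -/x -/y ex ey /flin => h.
  have PVf : p y *m (V a *m f x) = 0 by rewrite /x -hf mulmxA pf mul0mx.
  have : t *: F t = ((p y + t *: p1 y t) *m (t *: X a + V a) - C' t a *m (p x + t *: p1 x t)) *m f x.
    rewrite mulmxBl !(mulmxDl, mulmxDr) -!(scalemxAl, scalemxAr) -!mulmxA pf PVf mulmx0 /F -!mulmxA.
    move: (p1 y t *m (V a *m f x)) (p y *m (X a *m f x)) (p1 y t *m (X a *m f x)) (C' t a *m (p1 x t *m f x)).
    by move=> z1 z2 z3 z4; apply/matrixP => i j; rewrite !mxE; ring.
  rewrite h subrr mul0mx => /eqP; rewrite scaler_eq0 (negPf t0) /= => /eqP //.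
have := F0; rewrite /F C'0 scale0r addr0 => /eqP; rewrite subr_eq0 => /eqP <-.
rewrite addKr /X -/x -/y -!mulmxA rf mulmx1 mulmxA ps mul1mx //.
Qed.

Lemma wval_sub sigma d u : (forall x, u x <= d x)%N ->
  wval sigma (fun x => d x - u x)%N = wval sigma d - wval sigma u.
Proof.
move=> le; rewrite /wval -sumrB; apply: eq_bigr => x _.
by rewrite -mulrBr -subzn.
Qed.

Lemma rank0_eq0 b c (h : fam K c b) : (forall x, \rank (h x) = 0%N) -> forall x, h x = 0.
Proof. by move=> H x; apply/eqP; rewrite -mxrank_eq0 H. Qed.

Lemma hom_ker_dim b d k (B : rp b) (V : rp d) (f : fam K d b) :
  ishom B V f -> (forall x, k x = b x - \rank (f x))%N ->
  exists (N : rp k) (q : fam K b k) (r : fam K k b) (y : fam K b d),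
    [/\ ishom N B q, linv q r, (forall x, f x *m q x = 0)
      & forall x, 1%:M = q x *m r x + y x *m f x].
Proof.
by move=> hf /functional_extensionality kE; subst k; exact: hom_ker.
Qed.

Variable tau : involution Q.

Lemma wval_tau (sigma : weight Q) u : (forall x, sigma (inv0 tau x) = - sigma x) ->
  wval sigma (fun x => u (inv0 tau x)) = - wval sigma u.
Proof.
move=> st; rewrite /wval (reindex_inj (inv_inj (inv0K tau))) /= -sumrN.
by apply: eq_bigr => x _; rewrite st inv0K mulNr.
Qed.

Lemma destabilizing_perp (alpha : vertex Q -> nat) (sigma : weight Q) :
  acyclic Q -> (forall x, alpha (inv0 tau x) = alpha x) ->
  (forall x, sigma (inv0 tau x) = - sigma x) -> ~ nzsemi K alpha sigma ->
  exists beta gamma : vertex Q -> nat,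
    [/\ (forall x, alpha x = gamma x + beta x + beta (inv0 tau x))%N,
        perp beta gamma, perp beta (fun x => beta (inv0 tau x)) & 0 < wval sigma beta].
Proof.
move=> ac aT sT nS.
have sa0 : wval sigma alpha = 0.
  have := wval_tau alpha sT; rewrite (_ : (fun x => _) = alpha); first by lia.
  exact: functional_extensionality.
have [w [w_pos w_inj]] := digit_weights (vertex Q) (vtot alpha).+1.
pose W u := (\sum_x w x * u x)%N.
(* As [N] exceeds [W u] for all [u <= alpha], [sigma'] compares such [u] by [sigma] first and by
   smaller [W] second, and takes distinct values on distinct ones. *)
pose N := (W alpha).+1.
pose sigma' : weight Q := [ffun x => N%:Z * sigma x - (w x)%:Z].
have sigma'E u : wval sigma' u = N%:Z * wval sigma u - (W u)%:Z.
  rewrite /wval /W (big_morph Posz PoszD erefl) mulr_sumr -sumrB.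
  by apply: eq_bigr => x _; rewrite ffunE mulrBl mulrA PoszM.
have W_le u : (forall x, u x <= alpha x)%N -> (W u < N)%N.
  by move=> ua; rewrite ltnS; apply: leq_sum => x _; rewrite leq_mul2l ua orbT.
have a_le u x : (forall x, u x <= alpha x)%N -> (u x < (vtot alpha).+1)%N.
  move=> ua; rewrite ltnS; apply: leq_trans (ua x) _.
  by rewrite /vtot (bigD1 x) //= leq_addr.
have sigma'_inj u v : (forall x, u x <= alpha x)%N -> (forall x, v x <= alpha x)%N ->
    wval sigma' u = wval sigma' v -> forall x, u x = v x.
  move=> ua va E; apply: w_inj => [x|x|]; [exact: a_le|exact: a_le|].
  have := W_le _ ua; have := W_le _ va; rewrite -/(W u) -/(W v).
  move: E; rewrite !sigma'E; move: (wval sigma u) (wval sigma v) (W u) (W v) => a a' z z' E h h'.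
  have : N%:Z * (a - a') = z%:Z - z'%:Z by rewrite mulrBr; lia.
  have [->|n0] := eqVneq a a'; first by rewrite subrr mulr0; lia.
  have : (1 <= a - a') \/ (a - a' <= -1) by lia.
  nia.
pose P m d (V : rp d) :=
  (exists c (C : rp c) (p : fam K c d), lquot V C p /\ wval sigma' c = m)
    /\ forall c, iquot V c -> m <= wval sigma' c.
have [m [O [oO nO PO]]] := generic_min_quot K sigma' alpha ac.
have aTE : (fun x => alpha (inv0 tau x)) = alpha by exact: functional_extensionality.
have aTB u : (fun x => alpha (inv0 tau x) - u x)%N = (fun x => alpha x - u x)%N.
  by apply: functional_extensionality => x; rewrite aT.
(* The dual of [V] has dimension vector [alpha] composed with [tau], equal to [alpha] only by
   extensionality; the variable [d] permits rewriting along this equality. *)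
pose G d := exists O : rp d -> Prop, [/\ openF O, (exists V, O V) & forall V, O V -> P m _ V].
have [O' [oO' [V' OV'] PO']] : G (fun x => alpha (inv0 tau x)) by rewrite aTE; exists O.
(* The complex of [sigma] is square because [sigma(alpha) = 0]. It is never invertible, since its
   determinant would be a nonzero semi-invariant. *)
have [O2 [oO2 nO2 PO2]] : exists O2 : rp alpha -> Prop,
    [/\ openF O2, (exists V, O2 V) & forall V, O2 V -> exists c, iquot V c /\ wval sigma c < 0].
  have [b0 [m0 sE]] := acyclic_weight sigma ac.
  apply: (generic_neg_quot sE) => B M V; rewrite ltn_neqAle rank_leq_col andbT.
  apply/eqP => rE; apply: nS; apply: (det_semiinv sE rE).
  by have := sE alpha; rewrite sa0 => /esym/eqP; rewrite subr_eq0 => /eqP[].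
have [V0 V0E] := dual_surj V'.
have [||V [[OV O2V] O'V]] := openF_meet (openF_and oO oO2) (dual_openF oO').
- exact: openF_meet.
- by exists V0; rewrite V0E.
have [[c [C [p [lq sigma'c]]]] minV] := PO V OV.
have [[c' [C' [p' [lq' sigma'c2]]]] minV'] := PO' _ O'V.
have [c0 [qc0 neg0]] := PO2 V O2V.
have qc : iquot V c by exact: lquot_iquot lq.
have qc' : iquot (dual tau V) c' by exact: lquot_iquot lq'.
have ca x : (c x <= alpha x)%N by exact: iquot_le qc.
(* [V] and its dual have the same minimal weight [m], and [sigma'] separates dimension vectors. *)
have c'E : c' = c.
  apply: functional_extensionality; apply: sigma'_inj => [x|x|] //; last by rewrite sigma'c2.
  by have := iquot_le x qc'; rewrite aT.
subst c'; clear sigma'c2 lq' C' p'.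
pose beta x := (alpha x - c x)%N.
have ba x : (beta x <= alpha x)%N by exact: leq_subr.
have sigma'b : wval sigma' beta = wval sigma' alpha - m by rewrite wval_sub // sigma'c.
have subV u : isub V u -> wval sigma' u <= wval sigma' beta.
  move=> su; have ua x : (u x <= alpha x)%N by exact: isub_le su.
  by have := minV _ (isub_quot su); rewrite wval_sub // sigma'b; lia.
have quotV u : iquot V u -> wval sigma' (fun x => u (inv0 tau x)) <= wval sigma' beta.
  move=> /(dual_quot_sub tau) su.
  have ua x : (u (inv0 tau x) <= alpha x)%N by have := isub_le x su; rewrite aT.
  have := minV' _ (isub_quot su); rewrite (aTB (fun x => u (inv0 tau x))).
  by rewrite wval_sub // sigma'b; lia.
have [rkp hp _] := lq.
have [|B [f [r [s [hf rf pf fE]]]]] := @hom_ker_dim _ _ beta _ _ _ hp.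
  by move=> x; rewrite rkp.
have ps : linv s p.
  move=> x; have [z pz] := (rank_right_inv _).2 (rkp x).
  have : p x = p x *m s x *m p x.
    by rewrite -mulmxA -{1}[p x]mulmx1 (fE x) mulmxDr mulmxA pf mul0mx add0r.
  by move=> /(congr1 (mulmx^~ z)); rewrite -mulmxA pz mulmx1.
have fr x : \rank (f x) = beta x by apply/rank_left_inv; exists (r x).
have subB u : (forall x, u x <= beta x)%N -> isub B (fun x => beta x - u x)%N -> 0 <= wval sigma' u.
  by move=> ub /(isub_trans hf fr)/subV; rewrite wval_sub //; lia.
(* The image of [h] has weight at least 0 as a quotient of [B], and at most 0 because [C] modulo
   this image is a quotient of [V]; injectivity of [sigma'] makes it zero. *)
have homBC h : ishom B C h -> forall x, h x = 0.
  move=> hh; apply: rank0_eq0.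
  have rb x : (\rank (h x) <= beta x)%N by exact: rank_leq_col.
  have rc x : (\rank (h x) <= c x)%N by exact: rank_leq_row.
  have h1 := subB _ rb (isub_ker hh).
  have h2 := minV _ (iquot_trans hp rkp (iquot_coker hh)).
  rewrite wval_sub // sigma'c in h2.
  have E x : (c x - \rank (h x) = c x)%N.
    move: x; apply: sigma'_inj => [x||]; last by rewrite wval_sub // sigma'c; lia.
      exact: leq_trans (leq_subr _ _) (ca x).
    exact: ca.
  by move=> x; have := E x; have := rc x; lia.
have N1c := lquot_ext lq hf ps rf pf.
have N0c := rk_inj homBC.
have sD : isub (dual tau V) beta.
  by have := iquot_sub qc'; rewrite aTB.
pose delta x := beta (inv0 tau x).
have [D [q [hq rkq]]] : iquot V delta by exact: dual_sub_quot sD.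
(* [tau] reverses the sign of [sigma] but not that of [w]: the inequalities for [B] and for the dual
   of [V] add up to [W rh + W (rh \o tau) <= 0]. *)
have homBD h : ishom B D h -> forall x, h x = 0.
  move=> hh; apply: rank0_eq0; pose rh x := \rank (h x).
  have rb x : (rh x <= beta x)%N by exact: rank_leq_col.
  have rd x : (rh x <= delta x)%N by exact: rank_leq_row.
  have h1 := subB _ rb (isub_ker hh).
  have := quotV _ (iquot_trans hq rkq (iquot_coker hh)).
  have -> : (fun x => delta (inv0 tau x) - \rank (h (inv0 tau x)))%N = (fun x => beta x - rh (inv0 tau x))%N.
    by apply: functional_extensionality => x; congr (_ - _)%N; rewrite /delta inv0K.
  rewrite wval_sub => [h2|x]; last by have := rd (inv0 tau x); rewrite /delta inv0K.
  have : W rh = 0%N.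
    by move: h1 h2; rewrite !sigma'E wval_tau // -/rh; lia.
  move=> /eqP; rewrite sum_nat_eq0 => /forallP H x.
  by have := H x; rewrite muln_eq0 -leqn0 leqNgt w_pos /= => /eqP.
have qf x : q x *m f x = 0 by exact: (homBD _ (ishom_comp hf hq) x).
(* As [q f = 0], [q] factors through the cokernel [p] of [f], so [D] is a quotient of [C]. *)
pose g : fam K delta c := fun x => q x *m s x.
have gp x : g x *m p x = q x.
  by rewrite /g -mulmxA -[RHS]mulmx1 (fE x) mulmxDr !mulmxA qf mul0mx add0r.
have hg : ishom C D g.
  move=> a; have := hq a; rewrite -gp -[q (qtail a)]gp -mulmxA hp => /(congr1 (mulmx^~ (s (qtail a)))).
  by rewrite -!mulmxA ps !mulmx1.
have rkg x : \rank (g x) = delta x.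
  apply/rank_right_inv; have [z qz] := (rank_right_inv _).2 (rkq x).
  by exists (p x *m z); rewrite mulmxA gp.
have [sg gsg] := right_inv_fam rkg.
have perpD : N1 beta no_frame delta = rk B (frame0 beta) D.
  apply/eqP; rewrite eqn_leq rank_leq_col andbT.
  by have := coker_quot_le B (frame0 beta) hg gsg; rewrite N1c addnC leq_add2l.
have N0D := rk_inj homBD.
have dc x : (delta x <= c x)%N by rewrite -rkg rank_leq_col.
pose gamma x := (c x - delta x)%N.
have [|Ga [i [ri [y [hi iri gi iE]]]]] := @hom_ker_dim _ _ gamma _ _ _ hg.
  by move=> x; rewrite rkg.
have homBG h : ishom B Ga h -> forall x, h x = 0.
  move=> hh x; have := homBC _ (ishom_comp hh hi) x.
  by move=> /(congr1 (mulmx (ri x))); rewrite mulmxA iri mul1mx mulmx0.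
have N0G := rk_inj homBG.
have split_c x : c x = (gamma x + delta x)%N by rewrite subnK.
(* Both terms of the complex are additive on [c = gamma + delta], so the Euler characteristic
   vanishes at [gamma] as it does at [c] and [delta]. *)
have N0s : N0 beta c = (N0 beta gamma + N0 beta delta)%N.
  rewrite /N0 !card_fidx -big_split; apply: eq_bigr => x _.
  by rewrite split_c mulnDl.
have N1s : N1 beta no_frame c = (N1 beta no_frame gamma + N1 beta no_frame delta)%N.
  rewrite /N1 !card_fidx -big_split; apply: eq_bigr => -[a|x] _ /=.
    by rewrite split_c mulnDl.
  by rewrite split_c mulnDl.
have NG : N0 beta gamma = N1 beta no_frame gamma.
  by move: N0s N1s; rewrite perpD N0D -N0c N1c => -> /addIn.
exists beta, gamma; split.
- move=> x; rewrite -/(delta x) addnAC -split_c /beta addnC subnK //.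
- by split=> //; exists B, Ga; rewrite N0G.
- by split; [rewrite perpD N0D|exists B, D].
have u0 x : (c0 x <= alpha x)%N by exact: iquot_le qc0.
(* The kernel of the quotient of dimension [c0] has [sigma >= 1], hence [sigma' >= N - W > 0]; the
   maximum [sigma'(beta)] is then positive as well, and so is [sigma(beta)]. *)
have := subV _ (iquot_sub qc0); rewrite !sigma'E wval_sub // sa0.
have := W_le (fun x => alpha x - c0 x)%N (fun x => leq_subr _ _).
move: neg0; move: (wval sigma c0) (wval sigma beta) (W _) (W beta) => a b z z' a0 zN le.
have : N%:Z * (0 - a) >= N%:Z by nia.
nia.
Qed.

End Unstable.

(** * Polynomial curves and congruences modulo powers of the parameter *)

Section PolynomialCurves.
Variable K : numFieldType.

Definition evp n (p : {mpoly K[n]}) (v : 'I_n -> {poly K}) : {poly K} :=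
  \sum_(m <- msupp p) p@_m *: \prod_k v k ^+ m k.

Lemma horner_evp n (p : {mpoly K[n]}) v t : (evp p v).[t] = p.@[fun k => (v k).[t]].
Proof.
rewrite mevalE horner_sum; apply: eq_bigr => m _; rewrite hornerZ horner_prod.
by congr (_ * _); apply: eq_bigr => k _; rewrite horner_exp.
Qed.

Lemma evp_congr n (p : {mpoly K[n]}) (c : {poly K}) (v v' : 'I_n -> {poly K}) :
  (forall k, c %| v k - v' k) -> c %| evp p v - evp p v'.
Proof.
move=> H; have cM a a' b b' : c %| a - a' -> c %| b - b' -> c %| a * b - a' * b'.
  move=> ca cb; have -> : a * b - a' * b' = (a - a') * b + a' * (b - b') by ring.
  by apply: dvdp_add; [exact: dvdp_mulr|exact: dvdp_mull].
rewrite /evp -sumrB; elim: (msupp p) => [|m s IH]; first by rewrite big_nil dvdp0.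
rewrite big_cons; apply: dvdp_add => //; rewrite -scalerBr -mul_polyC; apply: dvdp_mull.
elim: (index_enum _) => [|k r IHr]; first by rewrite !big_nil subrr dvdp0.
rewrite !big_cons; apply: (cM) => //; elim: (m k) => [|e IHe]; first by rewrite !expr0 subrr dvdp0.
by rewrite !exprS; exact: (cM).
Qed.

Definition evm m n (t : K) (A : 'M[{poly K}]_(m, n)) : 'M[K]_(m, n) := map_mx (horner_eval t) A.

Lemma evmM m n p t (A : 'M_(m, n)) (B : 'M_(n, p)) : evm t (A *m B) = evm t A *m evm t B.
Proof. exact: map_mxM. Qed.

Lemma evmD m n t (A B : 'M_(m, n)) : evm t (A + B) = evm t A + evm t B.
Proof. exact: map_mxD. Qed.

Lemma evmB m n t (A B : 'M_(m, n)) : evm t (A - B) = evm t A - evm t B.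
Proof. exact: map_mxB. Qed.

Lemma evmZ m n t c (A : 'M_(m, n)) : evm t (c *: A) = c.[t] *: evm t A.
Proof. by apply/matrixP => i j; rewrite !mxE /horner_eval hornerM. Qed.

Lemma evmC m n t (A : 'M_(m, n)) : evm t (map_mx polyC A) = A.
Proof. by apply/matrixP => i j; rewrite !mxE /horner_eval hornerC. Qed.

Lemma evm0_factor m n (A : 'M[{poly K}]_(m, n)) : evm 0 A = 0 -> exists A', A = 'X *: A'.
Proof.
move=> A0; exists (\matrix_(i, j) (A i j %/ 'X)); apply/matrixP => i j; rewrite !mxE.
rewrite mulrC divpK // -['X]subr0 -polyC0 dvdp_XsubCl rootE.
by have /matrixP/(_ i j) := A0; rewrite !mxE /horner_eval => ->.
Qed.

End PolynomialCurves.

(** * Density of representations with a given subrepresentation dimension *)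

Section SubrepDense.
Variables (K : numFieldType) (Q : quiver).
Notation rp d := (fam K (fun a : arrow Q => d (qhead a)) (fun a : arrow Q => d (qtail a))).
Notation no_frame := (fun _ : vertex Q => 0%N).
Notation pfam m n := (forall i, 'M[{poly K}]_(m i, n i)).
Implicit Types b c d u : vertex Q -> nat.

(* [Ext(B, C) = 0]. *)
Definition ext0 b c (B : rp b) (C : rp c) := forall xi : forall a, 'M[K]_(c (qhead a), b (qtail a)),
  exists f : fam K c b, forall a, f (qhead a) *m B a - C a *m f (qtail a) = xi a.

Lemma rk_ext0 b c (B : rp b) (C : rp c) : rk B (frame0 K b) C = N1 b no_frame c -> ext0 B C.
Proof.
move=> rN xi.
pose xi' : fam K (tgt_row c) (tgt_col b no_frame) := fun i =>
  match i with inl a => xi a | inr x => 0 end.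
have : (vec xi' <= Dmx B (frame0 K b) C)%MS.
  by apply: submx_full; apply/eqP.
case/submxP => v; rewrite mul_lmx; last exact: dmap_linF.
move=> /(congr1 (fun v => unvec v)); rewrite !vecK => E.
by exists (unvec v) => a; have := congr1 (fun f => f (inl a)) E.
Qed.

Section Riccati.
Variables (b e : vertex Q -> nat).
Notation d := (fun x => b x + e x)%N.
Variables (B : rp b) (E : rp e) (V1 : rp d).
Hypothesis BE : ext0 B E.

Let X0 := 'X : {poly K}.
Let D a : 'M[K]_(b (qhead a) + e (qhead a), b (qtail a) + e (qtail a)) :=
  V1 a - block_mx (B a) 0 0 (E a).
Let lft m n (M : 'M[K]_(m, n)) : 'M[{poly K}]_(m, n) := map_mx polyC M.
Let V11 a := lft (B a) + X0 *: lft (ulsubmx (D a)).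
Let V12 a := X0 *: lft (ursubmx (D a)).
Let V21 a := X0 *: lft (dlsubmx (D a)).
Let V22 a := lft (E a) + X0 *: lft (drsubmx (D a)).

(* The residual of the equation saying that the graph of [X] is a
   subrepresentation of [B + E + t (V1 - (B + E))]. *)
Lemma riccati_approx n : exists (X : pfam e b) (R : forall a, 'M_(e (qhead a), b (qtail a))),
  forall a, V21 a + V22 a *m X (qtail a) - X (qhead a) *m (V11 a + V12 a *m X (qtail a)) = 'X^n *: R a.
Proof.
elim: n => [|n [X [R XR]]].
  exists (fun x => 0), V21 => a.
  by rewrite mulmx0 mul0mx addr0 subr0 expr0 scale1r.
(* At [t = 0] the residual is linearised by [Z |-> E Z - Z B], which is surjective as
   [Ext(B, E) = 0]; [z] is the next coefficient of [X]. *)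
have [z zE] := BE (fun a => evm 0 (R a)).
pose Z x := 'X^n *: lft (z x).
pose S a := R a + V22 a *m lft (z (qtail a)) - lft (z (qhead a)) *m (V11 a + V12 a *m X (qtail a))
  - X (qhead a) *m (V12 a *m lft (z (qtail a)))
  - 'X^n *: (lft (z (qhead a)) *m (V12 a *m lft (z (qtail a)))).
have S0 a : evm 0 (S a) = 0.
  have v12 : evm 0 (V12 a) = 0 by rewrite /V12 evmZ hornerX scale0r.
  have v11 : evm 0 (V11 a) = B a by rewrite /V11 evmD evmZ hornerX scale0r addr0 evmC.
  have v22 : evm 0 (V22 a) = E a by rewrite /V22 evmD evmZ hornerX scale0r addr0 evmC.
  rewrite /S; move: (V11 a) (V12 a) (V22 a) v11 v12 v22 => W11 W12 W22 v11 v12 v22.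
  rewrite !(evmB, evmD, evmZ, evmM) v12 v11 v22 !evmC !mul0mx !mulmx0 scaler0 !subr0 addr0.
  by rewrite -zE subrK subrr.
have [R' R'E] := fin_all_exists (fun a => evm0_factor (S0 a)).
exists (fun x => X x + Z x), R' => a.
rewrite exprSr -scalerA -R'E /S /Z.
have := XR a; move: (V21 a) (V22 a) (V12 a) (V11 a) (R a) (lft (z (qtail a))) (lft (z (qhead a))).
move: (X (qhead a)) (X (qtail a)) => Xh Xt W21 W22 W12 W11 Ra zt zh XRa.
rewrite !scalerBr !scalerDr -XRa !(mulmxDr, mulmxDl) -!(scalemxAl, scalemxAr).
move: (W22 *m Xt) (W22 *m zt) (Xh *m W11) (zh *m W11) (Xh *m (W12 *m Xt)).
move: (Xh *m (W12 *m zt)) (zh *m (W12 *m Xt)) (zh *m (W12 *m zt)) => *.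
by apply/matrixP => i j; rewrite !mxE; ring.
Qed.

(** Let [P] be [f] along the line from [B + E] to [V1]. Changing the lower left block by a multiple
    of ['X^n] turns the graph of [X] into a true subrepresentation, where [f] vanishes. So ['X^n]
    divides [P], and [n = size P] forces [P = 0]. *)
Lemma subrep_vanish (f : rp d -> K) : polf f ->
  (forall V, isub V b -> f V = 0) -> f V1 = 0.
Proof.
move=> [p pE] fsub.
pose Vp a := block_mx (V11 a) (V12 a) (V21 a) (V22 a).
have Vp1 : (fun a => evm 1 (Vp a)) = V1.
  apply: fam_ext => a; rewrite /Vp /V11 /V12 /V21 /V22 /evm map_block_mx.
  rewrite -!/(evm 1 _) !(evmD, evmZ, evmC) hornerX !scale1r.
  rewrite -[V1 a](subrK (block_mx (B a) 0 0 (E a))) -/(D a) -[in RHS](submxK (D a)) add_block_mx.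
  by rewrite !addr0 [B a + _]addrC [E a + _]addrC.
pose crd (W : forall a, 'M[{poly K}]_(b (qhead a) + e (qhead a), b (qtail a) + e (qtail a)))
  (k : 'I_#|fidx (fun a : arrow Q => (b (qhead a) + e (qhead a))%N) (fun a => (b (qtail a) + e (qtail a))%N)|) :=
  W (tag (enum_val k)) (tagged (enum_val k)).1 (tagged (enum_val k)).2.
have fE W t : f (fun a => evm t (W a)) = (evp p (crd W)).[t].
  rewrite pE horner_evp; apply: meval_eq => k.
  by rewrite !mxE.
rewrite -Vp1 fE.
suff -> : evp p (crd Vp) = 0 by rewrite horner0.
apply/eqP/negPn/negP => nz; set P := evp p _ in nz.
have [X [R XR]] := riccati_approx (size P).
pose W a := block_mx (V11 a) (V12 a) (V21 a - 'X^(size P) *: R a) (V22 a).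
have W0 : evp p (crd W) = 0.
  apply: poly_eq0_of_nonzero => t _; rewrite -fE; apply: fsub.
  exists (fun a => evm t (V11 a + V12 a *m X (qtail a))).
  exists (fun x => evm t (col_mx 1%:M (X x))); split; last first.
    move=> x; apply/rank_left_inv; exists (row_mx 1%:M 0).
    rewrite /evm map_col_mx mul_row_col mul0mx addr0 mul1mx.
    by apply/matrixP => i j; rewrite !mxE /horner_eval hornerMn hornerC.
  move=> a; rewrite -!evmM; congr evm; rewrite /W mul_col_mx mul_block_col !mulmx1 mul1mx.
  by congr col_mx; rewrite -XR; move: (V21 a) (V22 a *m _) (X _ *m _) => *; apply/matrixP => i j; rewrite !mxE; ring.
have : 'X^(size P) %| P - evp p (crd W).
  apply: evp_congr => k; rewrite /crd; case: (enum_val k) => a [i j] /=.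
  have -> : Vp a i j - W a i j = (Vp a - W a) i j by rewrite !mxE.
  have -> : Vp a - W a = 'X^(size P) *: block_mx 0 0 (R a) 0.
    by rewrite /Vp /W opp_block_mx add_block_mx !subrr scale_block_mx !scaler0 opprB addrC subrK.
  by rewrite mxE dvdp_mulr.
rewrite W0 subr0 => /(dvdp_leq nz); rewrite size_polyXn ltnn //.
Qed.

End Riccati.

(** Were the complex never surjective, a generic [V] would have a quotient of negative weight,
    contradicting [semiinv_quot] where [f] is nonzero. *)
Lemma nzsemi_rk b c (sigma : weight Q) :
  (forall u, wval sigma u = (N0 b u)%:Z - (N1 b no_frame u)%:Z) -> nzsemi K c sigma ->
  exists (B : rp b) (C : rp c), rk B (frame0 K b) C = N1 b no_frame c.
Proof.
move=> sE [f [sf nzf]]; apply: NNPP => H.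
have [|O [oO nO qO]] := @generic_neg_quot K Q sigma b no_frame c sE.
  move=> B M C; rewrite ltn_neqAle rank_leq_col andbT; apply/eqP => rE.
  apply: H; exists B, C; rewrite -rE; congr (rk B _ C).
  by apply: fam_ext => x; apply/matrixP => i [].
have [V [fV /qO[u [qu neg]]]] := openF_meet (polf_openF sf.1) oO nzf nO.
by have := semiinv_quot sf fV qu; rewrite leNgt neg.
Qed.

(** Vanishing of [Ext(B, C1)] and of [Ext(B, C2)] is open in [B], so one [B] satisfies both and
    [Ext(B, C1 + C2) = 0]. Then [f] is nonzero at some representation with a subrepresentation of
    dimension [b], to which [semiinv_sub] applies. *)
Lemma nzsemi_sub_le0 b c c' (sigma tau : weight Q) :
  (forall u, wval tau u = (N0 b u)%:Z - (N1 b no_frame u)%:Z) ->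
  nzsemi K c tau -> nzsemi K c' tau ->
  nzsemi K (fun x => b x + (c x + c' x))%N sigma -> wval sigma b <= 0.
Proof.
move=> tE /(nzsemi_rk tE)[B1 [C1 r1]] /(nzsemi_rk tE)[B2 [C2 r2]] [f [sf [V fV]]].
have op u (C : rp u) : openF (fun B : rp b => (N1 b no_frame u <= rk B (frame0 K b) C)%N).
  by move=> W HW; exact: (rk_ev HW (regF_const (frame0 K b)) (regF_const C)).
have [||B [h1 h2]] := openF_meet (op _ C1) (op _ C2).
- by exists B1; rewrite r1.
- by exists B2; rewrite r2.
have e1 : ext0 B C1 by apply: rk_ext0; apply/eqP; rewrite eqn_leq h1 rank_leq_col.
have e2 : ext0 B C2 by apply: rk_ext0; apply/eqP; rewrite eqn_leq h2 rank_leq_col.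
pose C : rp (fun x => c x + c' x)%N := fun a => block_mx (C1 a) 0 0 (C2 a).
have eC : ext0 B C.
  move=> xi; have [f1 E1] := e1 (fun a => usubmx (xi a)); have [f2 E2] := e2 (fun a => dsubmx (xi a)).
  exists (fun x => col_mx (f1 x) (f2 x)) => a.
  rewrite mul_col_mx /C mul_block_col !mul0mx addr0 add0r opp_col_mx add_col_mx E1 E2.
  exact: vsubmxK.
rewrite leNgt; apply/negP => pos; case/eqP: fV.
refine (@subrep_vanish b (fun x => c x + c' x)%N B C V eC f sf.1 _) => W sW; apply/eqP/negPn/negP => fW.
by have := semiinv_sub sf fW sW; rewrite leNgt pos.
Qed.

Lemma euler_frame0 (beta : dimvec Q) u :
  wval (euler_weight (dimZ beta)) u = (N0 beta u)%:Z - (N1 beta no_frame u)%:Z.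
Proof. by rewrite theta_euler big1 ?subr0 // => x _; rewrite mul0r. Qed.

Lemma perp_nzsemi (beta : dimvec Q) c : perp K beta c -> nzsemi K c (euler_weight (dimZ beta)).
Proof. by case=> e [B [C rE]]; exact: det_semiinv (euler_frame0 beta) rE e. Qed.

End SubrepDense.

(** * Translation to the given definitions, and the criterion *)

Lemma Sigma_nzsemi (R : realType) (Q : quiver) (alpha : dimvec Q) (sigma : weight Q) :
  Sigma R alpha sigma <-> nzsemi R[i] alpha sigma.
Proof.
have polE (f : rep R alpha -> R[i]) : polynomial_fun f <-> polf f.
  by split=> -[p pE]; exists p => V; rewrite pE; apply: meval_eq => k; rewrite mxE.
split=> -[f [[pf sf] nz]]; exists f; split=> //; split; try exact/polE.
  move=> g gU V; have := sf g gU V; rewrite /chi => <-; congr f.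
  by apply: fam_ext => a; rewrite /rep_act /GL_inv invmxK.
move=> g gU V; have := sf g gU V; rewrite /chi => <-; congr f.
by apply: fam_ext => a; rewrite /rep_act /GL_inv invmxK.
Qed.

Lemma pairing_wval (Q : quiver) (sigma : weight Q) (beta : dimvec Q) :
  pairing sigma (dimZ beta) = wval sigma beta.
Proof. by apply: eq_bigr => x _; rewrite ffunE. Qed.

Theorem theorem1p6 (R : realType) (Q : quiver) (tau : involution Q)
    (alpha : dimvec Q) (sigma : weight Q) :
  acyclic Q ->
  alpha = inv_act tau alpha ->
  sigma = - inv_act tau sigma ->
  (Sigma R alpha sigma <->
   forall beta gamma : dimvec Q,
     dimZ gamma = dimZ alpha - dimZ beta - dimZ (inv_act tau beta) ->
     Sigma R gamma (euler_weight (dimZ beta)) ->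
     Sigma R (inv_act tau beta) (euler_weight (dimZ beta)) ->
     pairing sigma (dimZ beta) <= 0).
Proof.
move=> ac aT sT; rewrite Sigma_nzsemi; split=> [Ss beta gamma gE|H].
  rewrite !Sigma_nzsemi pairing_wval => S1 S2.
  apply: (nzsemi_sub_le0 (euler_frame0 beta) S1 S2).
  rewrite (_ : (fun x => _) = alpha) //; apply: functional_extensionality => x.
  by have /ffunP/(_ x) := gE; rewrite !ffunE; lia.
apply: NNPP => nS.
have aT' x : alpha (inv0 tau x) = alpha x by rewrite [in RHS]aT ffunE.
have sT' x : sigma (inv0 tau x) = - sigma x by rewrite [in RHS]sT !ffunE opprK.
have [b [g [aE p1 p2]]] := destabilizing_perp ac aT' sT' nS.
pose beta : dimvec Q := [ffun x => b x]; pose gamma : dimvec Q := [ffun x => g x].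
have bE : b = beta by apply: functional_extensionality => x; rewrite ffunE.
have gE : g = gamma by apply: functional_extensionality => x; rewrite ffunE.
rewrite bE -pairing_wval ltNge (H beta gamma) //.
- by apply/ffunP => x; rewrite !ffunE aE; lia.
- by apply/Sigma_nzsemi; rewrite -gE; apply: perp_nzsemi; rewrite -bE.
- apply/Sigma_nzsemi; rewrite (_ : fun_of_fin _ = (fun x => b (inv0 tau x))).
    by apply: perp_nzsemi; rewrite -bE.
  by apply: functional_extensionality => x; rewrite !ffunE.
Qed.
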